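(* Let $\alpha\in\mathbb{R}\setminus\pi\mathbb{Z}$ and $f\in e_{-\alpha}C^\infty(\mathbf{T}^n_\alpha)$. Then the fractional Dirichlet problem of order $\alpha$ $$\begin{cases}\dfrac{\partial^2}{\partial t^2}\Big(e_\alpha(x)F_\alpha(x,t)\Big)+\displaystyle\sum_{j=1}^n\frac{\partial^2}{\partial x_j^2}\Big(e_\alpha(x)F_\alpha(x,t)\Big)=0,& t\in(0,\infty),\ x\in\mathbf{T}^n_\alpha,\\[2mm] F_\alpha(x,0)=f(x),& x\in\mathbf{T}^n_\alpha,\end{cases}$$ has a solution which is continuous on $[0,\infty)\times\mathbf{T}^n_\alpha$ and $C^\infty$ on $[0,\infty)\times\mathbf{T}^n_\alpha$, given by $$F_\alpha(x,t)=(f\overset{\alpha}{\ast}P^\alpha_t)(x)=\sum_{m\in\mathbb{Z}^n}\mathcal{F}_\alpha(f)(m)e^{-2\pi|m||\csc\alpha|t}K_{-\alpha}(m,x)$$ (the convolution expression being for $t>0$).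
   Context: Let $n\ge 1$ and $\alpha\in\mathbb{R}\setminus\pi\mathbb{Z}$. The fractional torus $\mathbf{T}^n_\alpha$ is the cube of side $|\sin\alpha|$ with opposite sides identified, represented by $[-|\sin\alpha|/2,|\sin\alpha|/2]^n$; functions on $\mathbf{T}^n_\alpha$ are functions on $\mathbb{R}^n$ that are $|\sin\alpha|$-periodic in each coordinate, equivalently functions on this cube, and integrals over $\mathbf{T}^n_\alpha$ are taken over this cube. Put $e_\alpha(x)=e^{\pi i|x|^2\cot\alpha}$, $e_{-\alpha}(x)=e^{-\pi i|x|^2\cot\alpha}$. $e_{-\alpha}C^\infty(\mathbf{T}^n_\alpha)$ is the space of functions $f=e_{-\alpha}g$ on the cube with $g$ a $C^\infty$ function that is $|\sin\alpha|$-periodic in each coordinate; for such $f$, $e_\alpha f$ denotes the periodic function $g$. Likewise, for functions $F(x,t)$ on the cube times $[0,\infty)$, continuity and smoothness on $[0,\infty)\times\mathbf{T}^n_\alpha$ are understood for the function $e_\alpha(x)F(x,t)$, regarded as $|\sin\alpha|$-periodic in $x$. Put $A_\alpha=\sqrt{1-i\cot\alpha}$ (principal branch), $e_\alpha(m,x)=e^{-2\pi i(m\cdot x)\csc\alpha}$, $K_\alpha(m,x)=A_\alpha^n e_\alpha(x)e_\alpha(m,x)e_\alpha(m)$; $K_{-\alpha}$ is obtained by replacing $\alpha$ by $-\alpha$. $\mathcal{F}_\alpha(f)(m)=\int_{\mathbf{T}^n_\alpha}f(x)K_\alpha(m,x)\,dx$, $m\in\mathbb{Z}^n$. For $g\in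 L^1(\mathbf{T}^n)$ ($1$-periodic in each coordinate), $(f\overset{\alpha}{\ast}g)(x)=|\csc\alpha|^n e_{-\alpha}(x)\int_{\mathbf{T}^n_\alpha}e_\alpha(y)f(y)\,g((x-y)\csc\alpha)\,dy$. The fractional Poisson kernel is $P^\alpha_t(x)=\sum_{m\in\mathbb{Z}^n}e^{-2\pi|m||\csc\alpha|t}e^{2\pi im\cdot x}$, $t>0$. *)

(* Defs.v *)
From HB Require Import structures.
From mathcomp Require Import all_boot all_order all_algebra finmap.
From mathcomp Require Import all_classical all_reals all_analysis.
From mathcomp Require Import complex.
From mathcomp.analysis.showcase Require summability.

Set Implicit Arguments.
Unset Strict Implicit.
Unset Printing Implicit Defensive.

Import Order.TTheory GRing.Theory Num.Theory.
Import numFieldNormedType.Exports.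

Local Open Scope classical_set_scope.
Local Open Scope ring_scope.
Local Open Scope complex_scope.

(* Num.Theory shadows the projections of R[i] with those of closed fields. *)
Local Notation Re := complex.Re.
Local Notation Im := complex.Im.

(* The norm of the normed module 'rV[R]_n is the sup norm (same topology);
   |x| and x . y below are the Euclidean ones. *)
Definition dotmul (R : realType) (n : nat) (x y : 'rV[R]_n) : R :=
  \sum_(j < n) x ord0 j * y ord0 j.

Definition enorm (R : realType) (n : nat) (x : 'rV[R]_n) : R :=
  Num.sqrt (dotmul x x).

Definition intvec (R : realType) (n : nat) (m : 'rV[int]_n) : 'rV[R]_n :=
  map_mx intr m.

Definition expi (R : realType) (theta : R) : R[i] :=
  cos theta +i* sin theta.

Section SmoothWithin.
Variables (R : realType) (V : normedModType R).
Implicit Types (E D : set V) (h k : V -> R).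

(* k is the derivative of h along v relative to D: only increments staying in
   D are used, so this is the two-sided derivative where the line is interior
   to D and a one-sided derivative where it meets the boundary of D. *)
Definition is_derive_within D (v : V) h k : Prop :=
  forall x, D x ->
    s^-1 * (h (x + s *: v) - h x)
      @[s --> within [set s : R | D (x + s *: v)] 0^'] --> k x.

(* All iterated derivatives of h of order <= r along the directions in E
   exist on D (in the sense above) and are continuous on D. *)
Fixpoint Cr_within (r : nat) E D h : Prop :=
  {within D, continuous h} /\
  match r with
  | 0%N => True
  | r'.+1 => forall v, E v ->
      exists2 k, is_derive_within D v h k & Cr_within r' E D k
  end.

Definition smooth_within E D (h : V -> R[i]) : Prop :=
  forall r, Cr_within r E D (fun x => Re (h x)) /\
            Cr_within r E D (fun x => Im (h x)).

Definition ccontinuous_within D (h : V -> R[i]) : Prop :=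
  {within D, continuous (fun x => Re (h x))} /\
  {within D, continuous (fun x => Im (h x))}.

Definition cderive (v : V) (h : V -> R[i]) (x : V) : R[i] :=
  'D_v (fun y => Re (h y)) x +i* 'D_v (fun y => Im (h y)) x.

End SmoothWithin.

Section CoordinateDirections.
Variables (R : realType) (n : nat).

Definition space_dir : set 'rV[R]_n :=
  [set v | exists j : 'I_n, v = delta_mx ord0 j].

Definition spacetime_dir : set ('rV[R]_n * R)%type :=
  [set v | (exists j : 'I_n, v = (delta_mx ord0 j, 0)) \/ v = (0, 1)].

Definition closed_halfspace : set ('rV[R]_n * R)%type :=
  [set p | 0 <= p.2].

Definition smooth (g : 'rV[R]_n -> R[i]) : Prop :=
  smooth_within space_dir setT g.

Definition periodic (L : R) (g : 'rV[R]_n -> R[i]) : Prop :=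
  forall (j : 'I_n) (x : 'rV[R]_n), g (x + L *: delta_mx ord0 j) = g x.

End CoordinateDirections.

(* The library's product m1 \x m2 is only canonically a (sigma-)finite measure
   for finite m1 and m2; this alias carries the sigma-finite structure. *)
Section SigmaFiniteProduct.
Context d1 d2 (T1 : measurableType d1) (T2 : measurableType d2) (R : realType).
Variables (m1 : {sigma_finite_measure set T1 -> \bar R})
          (m2 : {sigma_finite_measure set T2 -> \bar R}).

Definition sfin_prod : set (T1 * T2) -> \bar R := (m1 \x m2)%E.

HB.instance Definition _ := Measure.on sfin_prod.

Let sfin_prod_sigma_finite : sigma_finite setT sfin_prod.
Proof.
have /sigma_finiteP[F [TF ndF Foo]] := sigma_finiteT m1.
have /sigma_finiteP[G [TG ndG Goo]] := sigma_finiteT m2.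
exists (fun n => F n `*` G n).
  rewrite -setXTT TF TG predeqE => -[x y]; split.
    move=> [/= [n _ Fnx] [k _ Gky]]; exists (maxn n k) => //; split.
    - by move: x Fnx; exact/subsetPset/ndF/leq_maxl.
    - by move: y Gky; exact/subsetPset/ndG/leq_maxr.
  by move=> [n _ []/= ? ?]; split; exists n.
move=> k; have [? ?] := Foo k; have [? ?] := Goo k.
split; first exact: measurableX.
by rewrite /sfin_prod product_measure1E// lte_mul_pinfty// ge0_fin_numE.
Qed.

HB.instance Definition _ := Measure_isSigmaFinite.Build _ _ _ sfin_prod
  sfin_prod_sigma_finite.

End SigmaFiniteProduct.

Record sfinMeasureSpace (R : realType) := SfinMeasureSpace {
  sms_disp : measure_display ;
  sms_sort : measurableType sms_disp ;
  sms_meas : {sigma_finite_measure set sms_sort -> \bar R} }.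

(* Lebesgue measure on R^n, as the iterated product measure on
   R * (R * ( ... * unit)). *)
Fixpoint lebesgue_space (R : realType) (n : nat) : sfinMeasureSpace R :=
  match n with
  | 0%N => SfinMeasureSpace
      (dirac tt : {sigma_finite_measure set unit -> \bar R})
  | n'.+1 => SfinMeasureSpace
      (sfin_prod (@lebesgue_measure R) (sms_meas (lebesgue_space R n'))
        : {sigma_finite_measure set _ -> \bar R})
  end.

Fixpoint lebesgue_coord (R : realType) (n : nat) :
    sms_sort (lebesgue_space R n) -> nat -> R :=
  match n with
  | 0%N => fun _ _ => 0
  | n'.+1 => fun u i => if i is i'.+1 then lebesgue_coord u.2 i' else u.1
  end.

Definition lebesgue_point (R : realType) (n : nat)
    (u : sms_sort (lebesgue_space R n)) : 'rV[R]_n :=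
  \row_(j < n) lebesgue_coord u j.

Definition cintegral (R : realType) (n : nat) (D : set 'rV[R]_n)
    (h : 'rV[R]_n -> R[i]) : R[i] :=
  let mu := sms_meas (lebesgue_space R n) in
  let D' := (@lebesgue_point R n) @^-1` D in
  Rintegral mu D' (fun u => Re (h (lebesgue_point u))) +i*
  Rintegral mu D' (fun u => Im (h (lebesgue_point u))).

(* Unordered sums (limits over finite subsets, i.e. absolutely convergent
   series) of families of complex numbers. *)
Section UnorderedSums.
Variables (R : realType) (I : choiceType).
Implicit Type a : I -> R[i].

Definition csum a : R[i] :=
  summability.sum (R := R^o) (fun m => Re (a m)) +i*
  summability.sum (R := R^o) (fun m => Im (a m)).

Definition has_csum a (l : R[i]) : Prop :=
  summability.partial_sum (fun m => Re (a m)) @ summability.totally --> Re l /\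
  summability.partial_sum (fun m => Im (a m)) @ summability.totally --> Im l.

End UnorderedSums.

Section FractionalTorus.
Variables (R : realType) (n : nat).
Implicit Types (alpha t : R) (x y : 'rV[R]_n) (m : 'rV[int]_n).

Definition cotan alpha : R := cos alpha / sin alpha.
Definition csc alpha : R := (sin alpha)^-1.

Definition period alpha : R := `|sin alpha|.

Definition cube alpha : set 'rV[R]_n :=
  [set x | forall j : 'I_n, `|x ord0 j| <= period alpha / 2].

(* e_alpha(x); e_{-alpha}(x) is chirp (- alpha) x since cot is odd *)
Definition chirp alpha x : R[i] := expi (pi * enorm x ^+ 2 * cotan alpha).

(* sqrtc is the principal branch, with value in the closed right half-plane *)
Definition fracA alpha : R[i] := sqrtc (1 -i* cotan alpha).

Definition echar alpha m x : R[i] :=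
  expi (- (2 * pi * dotmul (intvec R m) x * csc alpha)).

Definition fracK alpha m x : R[i] :=
  fracA alpha ^+ n * chirp alpha x * echar alpha m x * chirp alpha (intvec R m).

Definition fracF alpha (f : 'rV[R]_n -> R[i]) m : R[i] :=
  cintegral (cube alpha) (fun x => f x * fracK alpha m x).

Definition fracconv alpha (f g : 'rV[R]_n -> R[i]) x : R[i] :=
  (`|csc alpha| ^+ n)%:C * chirp (- alpha) x *
  cintegral (cube alpha)
    (fun y => chirp alpha y * f y * g (csc alpha *: (x - y))).

Definition damping alpha t m : R :=
  expR (- (2 * pi * enorm (intvec R m) * `|csc alpha| * t)).

Definition fracPoisson alpha t x : R[i] :=
  csum (fun m => (damping alpha t m)%:C * expi (2 * pi * dotmul (intvec R m) x)).

(* f \in e_{-alpha} C^oo(T^n_alpha); only the values on the cube matter *)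
Definition chirp_smooth alpha (f : 'rV[R]_n -> R[i]) : Prop :=
  exists g : 'rV[R]_n -> R[i],
    [/\ smooth g, periodic (period alpha) g &
        forall x, cube alpha x -> f x = chirp (- alpha) x * g x].

(* G is e_alpha(x) F(x,t) on the cube, regarded as periodic in x; G is
   uniquely determined for t >= 0. *)
Definition is_periodic_lift alpha (F G : 'rV[R]_n -> R -> R[i]) : Prop :=
  forall t, 0 <= t ->
    periodic (period alpha) (G ^~ t) /\
    forall x, cube alpha x -> G x t = chirp alpha x * F x t.

Definition time_derive2 (G : 'rV[R]_n -> R -> R[i]) x t : R[i] :=
  cderive (1 : R^o) (cderive (1 : R^o) (G x)) t.

Definition space_derive2 (j : 'I_n) (G : 'rV[R]_n -> R -> R[i]) x t : R[i] :=
  cderive (delta_mx ord0 j) (cderive (delta_mx ord0 j) (G ^~ t)) x.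

(* G is the periodic lift of F *)
Definition frac_dirichlet alpha (f : 'rV[R]_n -> R[i])
    (F G : 'rV[R]_n -> R -> R[i]) : Prop :=
  (forall x t, 0 < t ->
     time_derive2 G x t + \sum_(j < n) space_derive2 j G x t = 0) /\
  (forall x, cube alpha x -> F x 0 = f x).

End FractionalTorus.

(* Main.v *)
From HB Require Import structures.
Require Import Defs.
From mathcomp Require Import all_boot all_order all_algebra finmap.
From mathcomp Require Import all_classical all_reals all_analysis.
From mathcomp Require Import complex ring lra.
From mathcomp.analysis.showcase Require summability.

(** The periodic datum g = e_alpha f has Fourier coefficients c_m that decrease faster
    than every power of |m|. The function
      G(x, t) = sum_m c_m e^(- 2 pi |m| |csc alpha| t) e^(2 pi i (m . x) csc alpha)
    is the periodic lift of the solution, and F = e_(- alpha) G. Four facts carry the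
    proof, with w = 2 pi csc alpha throughout.

    Regularity: the real and the imaginary part of G are series [hseries] whose terms are
    (u_m cos (w m . x) + v_m sin (w m . x)) e^(- rate_m t) with rapidly decreasing u and v.
    On the closed half-space t >= 0 such series may be differentiated term by term in x and
    in t (one-sidedly at t = 0), because the difference quotients of the terms are bounded
    by a summable family: [cvg_rsum] is dominated convergence for sums. The derivatives are
    series of the same kind, so all iterated derivatives exist and are continuous
    ([hseries_Cr]), and the multipliers - w^2 m_j^2 and rate_m^2 = w^2 |m|^2 cancel
    ([hseries_harmonic]).

    Decay of the coefficients: the derivative of a periodic function integrates to zero over
    a period ([rintegral_partial0], by Fubini and the fundamental theorem of calculus), so
    1 - Laplacian / w^2 acts on the coefficients as multiplication by 1 + |m|^2
    ([fourier_decay]).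

    Boundary values: G(x, 0) = g(x) is Fourier inversion ([fourier_inversion]). Both sides are
    continuous with the same coefficients, and a continuous periodic function orthogonal to
    all waves vanishes, which is shown by testing it against powers of a trigonometric
    polynomial that peaks at a given point ([wave_orthogonal_le0]).

    Convolution: for t > 0 the sum defining the Poisson kernel is exchanged with the integral
    over the cube ([poisson_convolution]). The chirps cancel, and the constants A_alpha and
    A_(- alpha) multiply to |csc alpha| ([fracA_mulN]), which identifies the terms of the
    Fourier series with those written with [fracF] and [fracK]. *)

Set Implicit Arguments.
Unset Strict Implicit.
Unset Printing Implicit Defensive.

Import Order.TTheory GRing.Theory Num.Theory.
Import numFieldNormedType.Exports.

Local Open Scope classical_set_scope.
Local Open Scope ring_scope.
Local Open Scope complex_scope.

Local Notation Re := complex.Re.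
Local Notation Im := complex.Im.

#[local] Existing Instance summability.totally_filter.

(** * Unconditional sums *)

Section UnconditionalSums.
Variables (R : realType) (I : choiceType).
Implicit Types (a b : I -> R) (J K : {fset I}).

Definition abs_summable a :=
  exists C, forall J, \sum_(i <- J) `|a i| <= C.

(** A real family indexed by I, summed unconditionally: the real and the
    imaginary parts of [csum] and [has_csum] are instances. *)
Definition rsum a : R := summability.sum (R := R^o) a.

Lemma partial_sumE a J : summability.partial_sum a J = \sum_(i <- J) a i.
Proof. by rewrite /summability.partial_sum big_seq_fsetE. Qed.

Lemma sum_fsetU a J K : [disjoint J & K]%fset ->
  \sum_(i <- (J `|` K)%fset) a i = \sum_(i <- J) a i + \sum_(i <- K) a i.
Proof.
move=> dJK; rewrite -big_cat/=; apply: perm_big; apply: uniq_perm => //.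
  rewrite cat_uniq !fset_uniq/= andbT; apply/hasPn => x xK; apply/negP => xJ.
  by move/fdisjointP : dJK => /(_ _ xJ); rewrite xK.
by move=> x; rewrite mem_cat inE.
Qed.

Lemma sum_fsetD a J K : (J `<=` K)%fset ->
  \sum_(i <- K) a i = \sum_(i <- J) a i + \sum_(i <- (K `\` J)%fset) a i.
Proof.
move=> JK; have {1}-> : K = (J `|` K `\` J)%fset.
  apply/fsetP => x; rewrite !inE; case: (boolP (x \in J)) => //= xJ.
  by rewrite (fsubsetP JK).
by apply: sum_fsetU; apply/fdisjointP => x xJ; rewrite inE xJ.
Qed.

Lemma abs_summable_le a b : (forall i, `|a i| <= `|b i|) ->
  abs_summable b -> abs_summable a.
Proof.
move=> ab [C HC]; exists C => J; apply: le_trans (HC J).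
by apply: ler_sum => i _.
Qed.

(** A finite set whose sum is within [e] of the supremum of the finite sums of
    [`|b i|] leaves at most [e] for every finite set disjoint from it. *)
Lemma abs_summable_tail b e : abs_summable b -> 0 < e ->
  exists J, forall K, [disjoint J & K]%fset -> \sum_(i <- K) `|b i| <= e.
Proof.
move=> [C HC] e0.
pose S := [set x | exists J, x = \sum_(i <- J) `|b i|].
have S0 : has_sup S.
  split; first by exists (\sum_(i <- fset0) `|b i|), fset0.
  by exists C => x [J ->].
have [_ [J ->] HJ] := sup_adherent e0 S0.
exists J => K dJK.
have : \sum_(i <- (J `|` K)%fset) `|b i| <= sup S.
  by apply: sup_ubound; [exact: (proj2 S0)|exists (J `|` K)%fset].
rewrite sum_fsetU//; lra.
Qed.

Lemma rsum_cvg a : abs_summable a ->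
  summability.partial_sum a @ summability.totally --> rsum a.
Proof.
move=> sa; rewrite /rsum /summability.sum.
suff : cvg ((summability.partial_sum a : {fset I} -> R^o) @ summability.totally) by [].
apply: cauchy_cvg; apply: cauchy_exP => e e0.
have [J HJ] := abs_summable_tail sa (divr_gt0 e0 (ltr0Sn R 1)).
exists (summability.partial_sum a J).
exists J => // K /= JK; rewrite -ball_normE /=.
rewrite !partial_sumE (sum_fsetD _ JK) opprD addrA subrr sub0r normrN.
apply: le_lt_trans (ler_norm_sum _ _ _) _.
apply: (@le_lt_trans _ _ (e / 2)); last lra.
by apply: HJ; apply/fdisjointP => x xJ; rewrite inE xJ.
Qed.

Lemma rsum_unique a l :
  summability.partial_sum a @ summability.totally --> l -> rsum a = l.
Proof.
move=> /= h; apply: (@cvg_lim R^o) => //.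
Qed.

(** The tail bound is uniform over all families dominated by [b]; this is what
    makes dominated limits and integrals of sums work. *)
Lemma rsum_tail b e : abs_summable b -> 0 < e ->
  exists J, forall K, (J `<=` K)%fset -> forall a, (forall i, `|a i| <= b i) ->
    `|rsum a - \sum_(i <- K) a i| <= e.
Proof.
move=> sb e0; have [J HJ] := abs_summable_tail sb e0.
exists J => K JK a ab.
have ab' i : `|a i| <= `|b i| by rewrite (le_trans (ab i))// ler_norm.
have sa := abs_summable_le ab' sb.
have h : (fun H => `|summability.partial_sum a H - \sum_(i <- K) a i|)
   @ summability.totally --> `|rsum a - \sum_(i <- K) a i|.
  apply: cvg_norm; apply: cvgB; [exact: rsum_cvg|exact: cvg_cst].
apply: (cvgr_to_le h).
exists K => // H /= KH; rewrite partial_sumE (sum_fsetD _ KH) addrC addKr.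
apply: le_trans (ler_norm_sum _ _ _) _.
apply: (@le_trans _ _ (\sum_(i <- (H `\` K)%fset) `|b i|)).
  by apply: ler_sum => i _.
apply: HJ; apply/fdisjointP => x xJ; rewrite inE (fsubsetP JK) //.
Qed.

(** Dominated convergence for unordered sums (Tannery). Continuity of the sum
    and its differentiation term by term are both instances: in the second case
    [q s i] is a difference quotient of the [i]-th term. *)
Lemma cvg_rsum T (F : set_system T) (FF : Filter F) (q : T -> I -> R) l b :
  abs_summable b -> (forall i, `|l i| <= b i) ->
  (\forall s \near F, forall i, `|q s i| <= b i) ->
  (forall i, q s i @[s --> F] --> l i) ->
  rsum (q s) @[s --> F] --> rsum l.
Proof.
move=> sb lb qb ql; apply/cvgrPdist_le => e e0.
have e3 : 0 < e / 3 by lra.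
have [J HJ] := rsum_tail sb e3.
have h : \sum_(i <- J) q s i @[s --> F] --> \sum_(i <- J) l i.
  by apply: cvg_big => [|i _]; [exact: add_continuous|exact: ql].
have {}h := (@cvgrPdist_le _ _ _ _ _ _ _).1 h _ e3.
near=> s.
have h1 := HJ J (fsubset_refl _) l lb.
have h2 : `|rsum (q s) - \sum_(i <- J) q s i| <= e / 3.
  by apply: (HJ J (fsubset_refl _)); near: s.
have h3 : `|\sum_(i <- J) l i - \sum_(i <- J) q s i| <= e / 3.
  by near: s; exact: h.
move: h1 h2 h3; rewrite !ler_norml; lra.
Unshelve. all: by end_near. Qed.

Lemma rsumD a b : abs_summable a -> abs_summable b ->
  rsum (fun i => a i + b i) = rsum a + rsum b.
Proof.
move=> sa sb; apply: rsum_unique.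
rewrite (_ : summability.partial_sum _ = fun J =>
   summability.partial_sum a J + summability.partial_sum b J).
  by apply: cvgD; exact: rsum_cvg.
by apply/funext => J; rewrite !partial_sumE big_split.
Qed.

Lemma rsumZ c a : abs_summable a -> rsum (fun i => c * a i) = c * rsum a.
Proof.
move=> sa; apply: rsum_unique.
rewrite (_ : summability.partial_sum _ = fun J =>
   c * summability.partial_sum a J).
  by apply: cvgMr; exact: rsum_cvg.
by apply/funext => J; rewrite !partial_sumE mulr_sumr.
Qed.

Lemma abs_summableD a b : abs_summable a -> abs_summable b ->
  abs_summable (fun i => a i + b i).
Proof.
move=> [C HC] [D HD]; exists (C + D) => J.
apply: le_trans (lerD (HC J) (HD J)); rewrite -big_split/=.
by apply: ler_sum => i _; exact: ler_normD.
Qed.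

Lemma abs_summableZ c a : abs_summable a -> abs_summable (fun i => c * a i).
Proof.
move=> [C HC]; exists (`|c| * C) => J.
apply: le_trans (ler_wpM2l (normr_ge0 c) (HC J)).
by rewrite mulr_sumr; apply: ler_sum => i _; rewrite normrM.
Qed.

End UnconditionalSums.

(** * Summability over the integer lattice *)

Section LatticeSums.
Variables (R : realType) (n : nat).
Implicit Types m : 'rV[int]_n.

(** A convergence factor on Z^n that is a product over the coordinates, so that
    its sums over boxes factor into one-dimensional sums. *)
Definition lattice_weight m : R :=
  \prod_(j < n) (1 + (m ord0 j)%:~R ^+ 2)^-1.

(** The bound telescopes: 4/(N+1) - 4/(N+2) = 4/((N+1)(N+2)) dominates
    1/(1+N^2), and 4 is large enough for every N. *)
Lemma sum_inv_1Dsqr_le N : \sum_(k < N) (1 + k%:R ^+ 2)^-1 <= 4 - 4 / N.+1%:R :> R.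
Proof.
elim: N => [|N IH]; first by rewrite big_ord0; lra.
rewrite big_ord_recr/=.
suff h : (1 + N%:R ^+ 2)^-1 <= 4 / N.+1%:R - 4 / N.+2%:R :> R.
  by apply: le_trans (lerD IH h) _; rewrite addrA subrK.
have N0 : 0 <= N%:R :> R by [].
rewrite -(natr1 N.+1) -(natr1 N).
have -> : 4 / (N%:R + 1) - 4 / (N%:R + 1 + 1) =
  4 / ((N%:R + 1) * (N%:R + 1 + 1)) :> R by field; lra.
rewrite -[X in X <= _]mul1r ler_pdivrMr; last by nra.
rewrite mulrAC ler_pdivlMr; nra.
Qed.

Lemma sum_image_le (I : choiceType) (T : finType) (F : T -> R) (h : I -> T)
    (J : {fset I}) : {in J &, injective h} -> (forall x, 0 <= F x) ->
  \sum_(i <- J) F (h i) <= \sum_x F x.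
Proof.
move=> hJ F0; rewrite -(big_map h xpredT F) big_uniq/=; last first.
  by rewrite map_inj_in_uniq.
by rewrite [leRHS](bigID (mem [seq h i | i <- J]))/= lerDl sumr_ge0.
Qed.

(** A finite set of lattice points lies in a box; over the box the sum of the
    products is the product of the sums, each at most 2 * 4 (sign, absolute value). *)
Lemma abs_summable_lattice_weight : abs_summable lattice_weight.
Proof.
exists (8 ^+ n) => J.
pose N := (\max_(m <- J) \max_(j < n) `|m ord0 j|)%N.
have HN m j : m \in J -> (`|m ord0 j| < N.+1)%N.
  move=> mJ; rewrite ltnS /N (big_rem m mJ)/= leq_max; apply/orP; left.
  exact: leq_bigmax.
pose F (p : bool * 'I_N.+1) : R := (1 + p.2%:R ^+ 2)^-1.
(* An integer is encoded by its sign and its absolute value, at most N. *)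
pose h m : {ffun 'I_n -> bool * 'I_N.+1} :=
  [ffun j => (m ord0 j < 0, inord `|m ord0 j|%N)].
have F0 p : 0 <= F p by rewrite invr_ge0 addr_ge0 ?sqr_ge0.
have -> : \sum_(m <- J) `|lattice_weight m| =
    \sum_(m <- J) \prod_(j < n) F (h m j).
  rewrite big_seq [RHS]big_seq; apply: eq_bigr => m mJ.
  rewrite ger0_norm; last by apply: prodr_ge0 => j _; rewrite invr_ge0 addr_ge0 ?sqr_ge0.
  apply: eq_bigr => j _; rewrite ffunE /F/= inordK ?HN//.
  by congr (_^-1); congr (_ + _); rewrite natr_absz intr_norm real_normK ?num_real.
pose P (f : {ffun 'I_n -> bool * 'I_N.+1}) : R := \prod_(j < n) F (f j).
apply: (@le_trans _ _ (\sum_f P f)).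
  apply: (@sum_image_le _ _ P h J); last by move=> f; exact: prodr_ge0.
  move=> m m' mJ m'J /ffunP hmm'; apply/rowP => j.
  have := hmm' j; rewrite !ffunE => -[e1 /(congr1 val)/=].
  rewrite !inordK ?HN// => e2.
  rewrite [LHS]intEsign [RHS]intEsign e2; congr (_ * _).
  by rewrite e1.
rewrite /P -(bigA_distr_bigA (fun _ => F)) prodr_const card_ord.
  apply: lerXn2r; rewrite ?nnegrE ?sumr_ge0//.
  rewrite -(pair_bigA _ (fun b k => F (b, k)))/= big_bool/= /F/=.
  have := sum_inv_1Dsqr_le N.+1.
  have : 0 <= 4 / N.+2%:R :> R by [].
  by move: (4 / _) => x; lra.
Qed.

End LatticeSums.

(** * Lebesgue measure and continuous functions on R^n *)

Section RowVectors.
Variables (R : realType) (n : nat).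
Implicit Types x y : 'rV[R]_n.

Lemma rV_norm_lt x (e : R) : 0 < e -> (forall j, `|x ord0 j| < e) -> `|x| < e.
Proof.
move=> e0 xe; have : ball x e 0.
  by split => // i j; rewrite ord1 mxE -ball_normE /= subr0.
by rewrite -ball_normE /= subr0.
Qed.

Lemma cvg_rV T (F : set_system T) (FF : Filter F) (f : T -> 'rV[R]_n) (l : 'rV[R]_n) :
  (forall j, f t ord0 j @[t --> F] --> l ord0 j) -> f @ F --> l.
Proof.
move=> fl; apply/cvgrPdist_lt => e e0.
have : \forall t \near F, forall j, `|l ord0 j - f t ord0 j| < e.
  apply: filter_forall => j; exact: (@cvgrPdist_lt _ _ _ _ _ _ _).1 (fl j) _ e0.
apply: filterS => t ht; apply: rV_norm_lt => // j.
by rewrite !mxE.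
Qed.

Lemma continuous_coord j : continuous (fun x : 'rV[R]_n => x ord0 j).
Proof. exact: coord_continuous. Qed.

End RowVectors.

Section LebesguePoint.
Variables (R : realType).

Lemma measurable_lebesgue_coord n i :
  measurable_fun setT (fun u : sms_sort (lebesgue_space R n) => lebesgue_coord u i).
Proof.
elim: n i => [|n IH] i /=; first exact: measurable_cst.
case: i => [|i]; first exact: measurable_fst.
exact: (measurableT_comp (IH i) measurable_snd).
Qed.

(** The half-open cube of side 1/(N+1) with corner k/(N+1), for c = (k, N); these
    countably many cells replace a countable base of open boxes. *)
Definition grid_cell n (c : 'rV[int]_n * nat) : set (sms_sort (lebesgue_space R n)) :=
  \bigcap_(j in [set: 'I_n]) ((fun u => lebesgue_coord u j) @^-1`
    `[(c.1 ord0 j)%:~R / c.2.+1%:R, ((c.1 ord0 j)%:~R + 1) / c.2.+1%:R[%classic).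

Lemma measurable_grid_cell n (c : 'rV[int]_n * nat) : measurable (grid_cell c).
Proof.
apply: fin_bigcap_measurable; first exact: finite_finset.
move=> j _; rewrite -[X in measurable X]setTI.
by apply: measurable_lebesgue_coord.
Qed.

(** Every open set is the union of the countably many grid cells it contains,
    because the cell of side 1/(N+1) around a point fits into any ball of larger
    radius. *)
Lemma open_preimage_measurable n (U : set 'rV[R]_n) : open U ->
  measurable (@lebesgue_point R n @^-1` U).
Proof.
move=> oU.
pose P := [set c : 'rV[int]_n * nat |
  grid_cell c `<=` @lebesgue_point R n @^-1` U].
have -> : @lebesgue_point R n @^-1` U = \bigcup_c (if c \in P then grid_cell c else set0).
  apply/seteqP; split => [u Uu|u [c _]]; last by case: ifPn => // /set_mem/[apply].
  have /nbhs_ballP[e /= e0 eU] : nbhs (lebesgue_point u) U by exact: open_nbhs_nbhs.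
  pose N := (Num.truncn e^-1).
  have Ne : N.+1%:R^-1 < e.
    by rewrite -(invrK e) ltf_pV2 ?posrE ?invr_gt0 ?ltr0n// truncnS_gt.
  have N0 : 0 < N.+1%:R :> R by rewrite ltr0n.
  exists (\row_j Num.floor (N.+1%:R * lebesgue_coord u j), N) => //.
  rewrite ifT.
    move=> j _ /=; rewrite in_itv/= mxE ler_pdivrMr // ltr_pdivlMr // (mulrC N.+1%:R).
    by have := floor_itv (lebesgue_coord u j * N.+1%:R); rewrite intrD.
  apply/mem_set => v /= cv; apply: eU; split => // i j.
  have := cv j I; rewrite /= in_itv/= mxE => /andP[h1 h2].
  have u1 : (Num.floor (N.+1%:R * lebesgue_coord u j))%:~R / N.+1%:R <= lebesgue_coord u j.
    by rewrite ler_pdivrMr // mulrC floor_le.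
  have u2 : lebesgue_coord u j <
      ((Num.floor (N.+1%:R * lebesgue_coord u j))%:~R + 1) / N.+1%:R.
    rewrite ltr_pdivlMr // mulrC.
    by have := floorD1_gt (N.+1%:R * lebesgue_coord u j); rewrite intrD.
  rewrite -ball_normE /= !mxE ltr_norml; move: h1 h2 u1 u2 Ne.
  by rewrite mulrDl mul1r; move: (_^-1) (_ / _) => a b; lra.
apply: countable_bigcupT_measurable; first exact: countableP.
by move=> c; case: ifPn => // _; exact: measurable_grid_cell.
Qed.

Lemma continuous_lebesgue_point_measurable n (h : 'rV[R]_n -> R) : continuous h ->
  measurable_fun setT (h \o @lebesgue_point R n).
Proof.
move=> /continuousP ch; apply: (measurability _ (measurable_realfun.RGenOpens.measurableE R)).
move=> _ [_ [a [b ->] <-]]; rewrite setTI comp_preimage.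
exact/open_preimage_measurable/ch/interval_open.
Qed.

End LebesguePoint.

Section BoxIntegral.
Variables (R : realType).
Implicit Types (n : nat) (a : R).

(** For [a] half the period, [box a] is [cube alpha]. *)
Definition box n a : set 'rV[R]_n := [set x | forall j, `|x ord0 j| <= a].

(** The real and imaginary parts of [cintegral] are of this form. *)
Definition rintegral n (D : set 'rV[R]_n) (h : 'rV[R]_n -> R) : R :=
  Rintegral (sms_meas (lebesgue_space R n)) (@lebesgue_point R n @^-1` D)
    (fun u => h (lebesgue_point u)).

(** The measure is an iterated product, so products of sets have the expected
    measure by induction on the dimension. *)
Lemma lebesgue_space_prod n (A : nat -> set R) : (forall i, measurable (A i)) ->
  let P := [set u : sms_sort (lebesgue_space R n) |
              forall j : 'I_n, A j (lebesgue_coord u j)] in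
  measurable P /\
  sms_meas (lebesgue_space R n) P = (\prod_(i < n) lebesgue_measure (A i))%E.
Proof.
elim: n A => [|n IH] A mA /=.
  have -> : [set u : unit | forall j : 'I_0, A j 0] = setT.
    by apply/seteqP; split => // u _ [].
  by split; [exact: measurableT|rewrite big_ord0 diracT].
have [mP muP] := IH (fun i => A i.+1) (fun i => mA i.+1).
set P := [set u | _] in mP muP.
have -> : [set u : R * sms_sort (lebesgue_space R n) | forall j : 'I_n.+1,
    A j (match val j with 0%N => u.1 | i.+1 => lebesgue_coord u.2 i end)] = A 0%N `*` P.
  apply/seteqP; split => [u Au|u [Au Pu] j].
    split; first exact: (Au ord0).
    by move=> j; exact: (Au (lift ord0 j)).
  by case: j => -[|i] i1 //; exact: (Pu (Ordinal (i1 : (i < n)%N))).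
split; first exact: (measurableX (mA 0%N) mP).
rewrite big_ord_recl /=.
have H := product_measure1E lebesgue_measure (sms_meas (lebesgue_space R n)) (mA 0%N) mP.
by rewrite -muP; exact: H.
Qed.

Lemma preimage_boxE a n : @lebesgue_point R n @^-1` box a =
  [set u | forall j : 'I_n, `[- a, a]%classic (lebesgue_coord u j)].
Proof.
by apply/seteqP; split => u /= ua j; have := ua j; rewrite in_itv/= mxE ler_norml.
Qed.

Lemma measurable_box n a : measurable (@lebesgue_point R n @^-1` box a).
Proof.
rewrite preimage_boxE.
by have [] := @lebesgue_space_prod n (fun=> `[- a, a]%classic) (fun=> measurable_itv _).
Qed.

Lemma measure_box n a : 0 <= a ->
  sms_meas (lebesgue_space R n) (@lebesgue_point R n @^-1` box a) =
  ((2 * a) ^+ n)%:E.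
Proof.
move=> a0; rewrite preimage_boxE.
have [_ ->] := @lebesgue_space_prod n (fun=> `[- a, a]%classic) (fun=> measurable_itv _).
rewrite (eq_bigr (fun=> (2 * a)%:E)); last first.
  move=> i _; rewrite lebesgue_measure_itv /= lte_fin; case: ifPn => h.
    by rewrite -EFinB; congr (_%:E); lra.
  by congr (_%:E); lra.
by rewrite prodEFin prodr_const card_ord.
Qed.

Lemma compact_box n a : compact (box a : set 'rV[R]_n).
Proof.
have := @rV_compact R n (fun=> `[- a, a]%classic) (fun=> @segment_compact _ _ _).
rewrite (_ : [set v : 'rV[R]_n | _] = box a) //.
by apply/seteqP; split => u /= ua j; have := ua j; rewrite in_itv/= ler_norml.
Qed.

Lemma continuous_bounded_box n a (h : 'rV[R]_n -> R) : continuous h ->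
  exists2 M, 0 <= M & forall x, box a x -> `|h x| <= M.
Proof.
move=> ch.
have /compact_bounded[M [_ HM]] : compact (h @` box a).
  apply: continuous_compact; last exact: compact_box.
  exact: continuous_subspaceT.
exists (`|M| + 1); first by rewrite addr_ge0.
move=> x bx; apply: (HM (`|M| + 1)); last by exists x.
by rewrite ltr_pwDr// ler_norm.
Qed.

Lemma integrable_box n a (h : 'rV[R]_n -> R) : 0 <= a -> continuous h ->
  (sms_meas (lebesgue_space R n)).-integrable (@lebesgue_point R n @^-1` box a)
    (EFin \o (fun u => h (lebesgue_point u))).
Proof.
move=> a0 ch; apply: measurable_bounded_integrable.
- exact: measurable_box.
- apply: le_lt_trans (ltry ((2 * a) ^+ n)).
  by rewrite le_eqVlt; apply/orP; left; apply/eqP; exact: measure_box.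
- exact: (measurable_funTS (continuous_lebesgue_point_measurable ch)).
- have [M M0 HM] := continuous_bounded_box a ch.
  exists M; split; first by rewrite num_real.
  by move=> x Mx u bu /=; apply: le_trans (ltW Mx); exact: HM.
Qed.

Section Theory.
Variables (n : nat) (a : R).
Hypothesis a0 : 0 <= a.
Implicit Types h k : 'rV[R]_n -> R.
Local Notation I := (rintegral (box a : set 'rV[R]_n)).

Lemma eq_rintegral h k : (forall x, box a x -> h x = k x) -> I h = I k.
Proof. by move=> hk; apply: eq_Rintegral => u /set_mem bu; rewrite hk. Qed.

Lemma rintegralD h k : continuous h -> continuous k ->
  I (fun x => h x + k x) = I h + I k.
Proof.
by move=> ch ck; apply: RintegralD;
  [exact: measurable_box|exact: integrable_box|exact: integrable_box].
Qed.

Lemma rintegralZ c h : continuous h -> I (fun x => c * h x) = c * I h.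
Proof.
by move=> ch; apply: RintegralZl; [exact: measurable_box|exact: integrable_box].
Qed.

Lemma rintegral_cst c : I (fun=> c) = c * (2 * a) ^+ n.
Proof.
rewrite /rintegral Rintegral_cst; last exact: measurable_box.
by congr (_ * _); exact: (congr1 fine (measure_box n a0)).
Qed.

Lemma le_rintegral h k : continuous h -> continuous k ->
  (forall x, box a x -> h x <= k x) -> I h <= I k.
Proof.
move=> ch ck hk; apply: le_Rintegral;
  [exact: measurable_box|exact: integrable_box|exact: integrable_box|].
by move=> u bu; exact: hk.
Qed.

Lemma norm_rintegral_le h M : continuous h ->
  (forall x, box a x -> `|h x| <= M) -> `|I h| <= M * (2 * a) ^+ n.
Proof.
move=> ch hM; rewrite -rintegral_cst ler_norml; apply/andP; split.
  rewrite -mulN1r -rintegralZ; last exact: cst_continuous.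
  apply: le_rintegral => //; first by move=> x; apply: cst_continuous.
  by move=> x /hM; rewrite ler_norml mulN1r => /andP[].
apply: le_rintegral => //; first by move=> x; apply: cst_continuous.
by move=> x /hM; rewrite ler_norml => /andP[].
Qed.

End Theory.

End BoxIntegral.
(** * Fubini and the divergence theorem on the torus *)

Section RowCons.
Variables (R : realType) (n : nat).
Implicit Types (x : R) (v : 'rV[R]_n).

Definition row_cons x v : 'rV[R]_n.+1 :=
  \row_j (if unlift ord0 j is Some i then v ord0 i else x).

Lemma row_cons0 x v : row_cons x v ord0 ord0 = x.
Proof. by rewrite mxE unlift_none. Qed.

Lemma row_consS x v i : row_cons x v ord0 (lift ord0 i) = v ord0 i.
Proof. by rewrite mxE liftK. Qed.

(** Used to restrict a continuous function of n+1 variables to n variables or to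
    one. *)
Lemma row_cons_cvg T (F : set_system T) (FF : Filter F) (f : T -> R)
    (g : T -> 'rV[R]_n) x v :
  f @ F --> x -> g @ F --> v -> row_cons (f t) (g t) @[t --> F] --> row_cons x v.
Proof.
move=> fx gv; apply: cvg_rV => j; rewrite mxE.
under eq_fun do rewrite mxE.
case: unliftP => [i _|_] //.
exact: (cvg_comp _ _ gv (@continuous_coord _ _ i v)).
Qed.

Lemma row_consDl x v s (i : 'I_n) :
  row_cons x v + s *: delta_mx ord0 (lift ord0 i) =
  row_cons x (v + s *: delta_mx ord0 i).
Proof.
apply/rowP => j; rewrite !mxE /=; case: unliftP => [k ->|->] /=.
  by rewrite !mxE (inj_eq lift_inj).
by rewrite mulr0 addr0.
Qed.

Lemma row_consDr x v s :
  row_cons x v + s *: delta_mx ord0 ord0 = row_cons (x + s) v.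
Proof.
apply/rowP => j; rewrite !mxE /=; case: unliftP => [k ->|->] /=.
  by rewrite mulr0 addr0.
by rewrite mulr1.
Qed.

Lemma lebesgue_pointS (u : sms_sort (lebesgue_space R n.+1)) :
  lebesgue_point u = row_cons u.1 (lebesgue_point u.2).
Proof.
apply/rowP => j; rewrite !mxE; case: unliftP => [k ->|->] //=.
by rewrite !mxE.
Qed.

Lemma boxS a x v : box a (row_cons x v) <-> `[- a, a]%classic x /\ box a v.
Proof.
rewrite /= in_itv /= -ler_norml; split=> [b|[xa va] j].
  split; first by have := b ord0; rewrite row_cons0.
  by move=> j; have := b (lift ord0 j); rewrite row_consS.
by rewrite mxE; case: unliftP => [k _|_]; [exact: va|exact: xa].
Qed.

End RowCons.

Section IteratedIntegral.
Variables (R : realType) (n : nat) (a : R) (h : 'rV[R]_n.+1 -> R).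
Hypotheses (a0 : 0 <= a) (ch : continuous h).

Let f : R * sms_sort (lebesgue_space R n) -> \bar R :=
  (EFin \o (fun u => h (lebesgue_point u))) \_
    (@lebesgue_point R n.+1 @^-1` box a).

Let f_integrable : (lebesgue_measure \x sms_meas (lebesgue_space R n))%E.-integrable setT f.
Proof.
have := integrable_box a0 ch.
move/(integrable_mkcond _ (measurable_box _ _)) => H.
exact: H.
Qed.

Let integral_f : rintegral (box a) h =
  fine (\int[(lebesgue_measure \x sms_meas (lebesgue_space R n))%E]_u f u)%E.
Proof. by rewrite /rintegral /Rintegral integral_mkcond. Qed.

Let fE x u : f (x, u) =
  if (x \in `[- a, a]%classic) && (u \in @lebesgue_point R n @^-1` box a)
  then (h (row_cons x (lebesgue_point u)))%:E else 0%E.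
Proof.
rewrite /f patchE /= lebesgue_pointS /=; congr (if _ then _ else _).
apply/idP/andP => [/set_mem /=|[/set_mem xa /set_mem /= ua]].
  by rewrite lebesgue_pointS => /boxS[xa ua]; split; apply/mem_set.
by apply/mem_set => /=; rewrite lebesgue_pointS; apply/boxS.
Qed.

(** The first form of Fubini that is needed: integrate first over the last n
    coordinates. *)
Lemma rintegral_eq0_tail :
  (forall x, rintegral (box a) (fun v => h (row_cons x v)) = 0) ->
  rintegral (box a) h = 0.
Proof.
move=> h0; rewrite integral_f -integral12_prod_meas1 // integral0_eq// => x _.
rewrite /fubini_F; under eq_integral do rewrite fE.
have [xa|xa] := boolP (x \in `[- a, a]%classic); last exact: integral0_eq.
rewrite -(integral_mkcond _ (fun u => (h (row_cons x (lebesgue_point u)))%:E)).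
have chx : continuous (fun v => h (row_cons x v)).
  move=> v; apply: continuous_comp; last exact: ch.
  exact: (@row_cons_cvg _ _ _ (nbhs v) _ (fun=> x) id x v (cvg_cst x) cvg_id).
rewrite -[LHS]fineK; first exact: (congr1 EFin (h0 x)).
apply: integrable_fin_num; first exact: measurable_box.
exact: (integrable_box a0 chx).
Qed.

(** The second form: integrate first over the head coordinate. The inner integral
    is kept extended-real, the form in which the fundamental theorem of calculus
    provides it. *)
Lemma rintegral_eq0_head :
  (forall v, \int[lebesgue_measure]_(x in `[(- a)%R, a]) (h (row_cons x v))%:E = 0)%E ->
  rintegral (box a) h = 0.
Proof.
move=> h0; rewrite integral_f -integral21_prod_meas1 // integral0_eq// => u _.
rewrite /fubini_G; under eq_integral do rewrite fE.
have [ua|ua] := boolP (u \in @lebesgue_point R n @^-1` box a); last first.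
  by apply: integral0_eq => x _; rewrite andbF.
under eq_integral do rewrite andbT.
by rewrite -[RHS](h0 (lebesgue_point u)) [RHS]integral_mkcond.
Qed.

End IteratedIntegral.

Section DivergenceTheorem.
Variable R : realType.

Lemma is_derive_lim (V : normedModType R) (x v : V) (h : V -> R) (l : R) :
  is_derive x v h l <-> s^-1 * (h (x + s *: v) - h x) @[s --> 0^'] --> l.
Proof.
have E : (fun s : R => s^-1 * (h (x + s *: v) - h x)) =
    (fun s => s^-1 *: ((h \o shift x) (s *: v) - h x)).
  by apply/funext => s /=; rewrite [x + _]addrC.
split=> [[/cvg_ex[l' hl]]|].
  by rewrite E /derive (cvg_lim (@Rhausdorff R) hl) => <-.
rewrite E => hl; apply: DeriveDef; first by apply: cvgP hl.
exact: (cvg_lim (@Rhausdorff R) hl).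
Qed.

Lemma is_derive_withinT (V : normedModType R) (v : V) (h k : V -> R) :
  is_derive_within setT v h k <-> forall x, is_derive x v h (k x).
Proof.
have W x : within [set s : R | setT (x + s *: v)] 0^' = 0^' :> set_system R.
  apply/seteqP; split => A; rewrite /within /=; last by apply: filterS.
  by move=> /filterS; apply => s; apply.
split=> [hk x|hk x _]; first by apply/is_derive_lim; have := hk x I; rewrite W.
by rewrite W; apply/is_derive_lim.
Qed.

(** The divergence theorem on a torus. Fubini isolates coordinate [j], along which
    the integral of the derivative over a period is a difference of equal values. *)
Lemma rintegral_partial0 n (a : R) (j : 'I_n) (h k : 'rV[R]_n -> R) : 0 < a ->
  continuous k -> is_derive_within setT (delta_mx ord0 j) h k ->
  (forall x, h (x + (2 * a) *: delta_mx ord0 j) = h x) ->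
  rintegral (box a) k = 0.
Proof.
move=> a0; elim: n j h k => [[]//|n IH] j h k ck hk ph.
case: (unliftP ord0 j) => [i|] jE; subst j.
  apply: rintegral_eq0_tail => //; first exact: ltW.
  move=> x; apply: (IH i (fun v => h (row_cons x v))).
  - move=> v; apply: continuous_comp; last exact: ck.
    exact: (@row_cons_cvg _ _ _ (nbhs v) _ (fun=> x) id x v (cvg_cst x) cvg_id).
  - move=> v _; have := hk (row_cons x v) I.
    by rewrite (_ : (fun s : R => _) = fun s : R =>
      s^-1 * (h (row_cons x (v + s *: delta_mx ord0 i)) - h (row_cons x v)));
      [exact|apply/funext => s; rewrite row_consDl].
  - by move=> v; rewrite -row_consDl ph.
apply: rintegral_eq0_head => //; first exact: ltW.
move=> v; pose F x := h (row_cons x v).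
have dF x : is_derive x (1 : R) F (k (row_cons x v)).
  apply: (is_derive_withinT (1 : R^o) F (fun x => k (row_cons x v))).1 => {}x _.
  have := hk (row_cons x v) I.
  rewrite (_ : (fun s : R => _) = fun s : R => s^-1 * (F (x + s *: 1) - F x));
    first exact.
  by apply/funext => s; rewrite row_consDr [_ *: 1]mulr1.
have cF : continuous F.
  by move=> x; apply: differentiable_continuous; apply/derivable1_diffP; case: (dF x).
rewrite (@continuous_FTC2 _ (fun x => k (row_cons x v)) F).
- rewrite -EFinB; congr EFin; apply/eqP; rewrite subr_eq0 /F; apply/eqP.
  rewrite -[RHS](ph (row_cons (- a) v)) row_consDr; congr (h (row_cons _ v)).
  lra.
- lra.
- apply: continuous_subspaceT => x; apply: continuous_comp; last exact: ck.
  exact: (@row_cons_cvg _ _ _ (nbhs x) _ id (fun=> v) x v cvg_id (cvg_cst v)).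
- split.
  + by move=> x _; case: (dF x).
  + by apply: cvg_at_right_filter; exact: cF.
  + by apply: cvg_at_left_filter; exact: cF.
- by move=> x _; rewrite derive1E; case: (dF x).
Qed.

End DivergenceTheorem.

(** * Trigonometric waves *)

Section RealContinuity.
Variables (R : realType) (T : topologicalType).
Implicit Types f g : T -> R.

Lemma continuous_cstr (c : R) : continuous (fun _ : T => c).
Proof. by move=> x; exact: cvg_cst. Qed.

Lemma continuous_addr f g : continuous f -> continuous g ->
  continuous (fun x => f x + g x).
Proof. by move=> cf cg x; apply: cvgD; [exact: cf|exact: cg]. Qed.

Lemma continuous_mulr f g : continuous f -> continuous g ->
  continuous (fun x => f x * g x).
Proof. by move=> cf cg x; apply: cvgM; [exact: cf|exact: cg]. Qed.

Lemma continuous_oppr f : continuous f -> continuous (fun x => - f x).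
Proof. by move=> cf x; apply: cvgN; exact: cf. Qed.

Lemma continuous_exprn f N : continuous f -> continuous (fun x => f x ^+ N).
Proof.
move=> cf; elim: N => [|N IH].
  by under eq_fun do rewrite expr0; exact: continuous_cstr.
by under eq_fun do rewrite exprS; exact: continuous_mulr.
Qed.

Lemma continuous_sumr (I : Type) (s : seq I) (f : I -> T -> R) :
  (forall i, continuous (f i)) -> continuous (fun x => \sum_(i <- s) f i x).
Proof.
move=> cf; elim: s => [|i s IH].
  by under eq_fun do rewrite big_nil; exact: continuous_cstr.
by under eq_fun do rewrite big_cons; exact: continuous_addr.
Qed.

Lemma continuous_cos_comp f : continuous f -> continuous (fun x => cos (f x)).
Proof.
by move=> cf x; apply: (@continuous_comp _ _ _ f cos); [exact: cf|exact: continuous_cos].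
Qed.

End RealContinuity.

Section Waves.
Variables (R : realType) (n : nat) (w : R).
Implicit Types (m : 'rV[int]_n) (x y : 'rV[R]_n) (th : R).

(** The squared Euclidean length of the frequency [m]. *)
Definition freq m : R := dotmul (intvec R m) (intvec R m).

Definition phase m y : R := w * dotmul (intvec R m) y.

(** Working with real cosines of arbitrary phase avoids complex exponentials:
    differentiation shifts the phase by a quarter turn, and products of waves are
    sums of waves. *)
Definition wave m th y : R := cos (phase m y + th).

Lemma phase_delta m x s j :
  phase m (x + s *: delta_mx ord0 j) = phase m x + s * (w * (m ord0 j)%:~R).
Proof.
rewrite /phase /dotmul mulrCA -mulrDr; congr (_ * _).
rewrite (bigD1 j)//= [in RHS](bigD1 j)//= !mxE !eqxx mulr1.
rewrite (eq_bigr (fun i => intvec R m ord0 i * x ord0 i)); first by ring.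
by move=> i /negbTE ij; rewrite !mxE ij mulr0 addr0.
Qed.

Lemma phaseDl m m' x : phase (m + m') x = phase m x + phase m' x.
Proof.
rewrite /phase -mulrDr /dotmul -big_split/=; congr (_ * _).
by apply: eq_bigr => j _; rewrite !mxE intrD mulrDl.
Qed.

Lemma phaseN m x : phase (- m) x = - phase m x.
Proof.
rewrite /phase -mulrN /dotmul -sumrN; congr (_ * _).
by apply: eq_bigr => j _; rewrite !mxE intrN mulNr.
Qed.

Lemma phaseB m x y : phase m (x - y) = phase m x - phase m y.
Proof.
rewrite /phase -mulrBr /dotmul -sumrB; congr (_ * _).
by apply: eq_bigr => j _; rewrite !mxE mulrBr.
Qed.

Lemma phase0 x : phase 0 x = 0.
Proof. by rewrite /phase /dotmul big1 ?mulr0// => j _; rewrite !mxE mul0r. Qed.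

Lemma phase_unit j x : phase (delta_mx ord0 j) x = w * x ord0 j.
Proof.
rewrite /phase /dotmul (bigD1 j)//= big1.
  by rewrite !mxE !eqxx mul1r addr0.
by move=> i /negbTE ij; rewrite !mxE ij mul0r.
Qed.

Lemma continuous_phase m : continuous (phase m).
Proof.
apply: continuous_mulr; first exact: continuous_cstr.
apply: continuous_sumr => j; apply: continuous_mulr; first exact: continuous_cstr.
exact: continuous_coord.
Qed.

Lemma continuous_wave m th : continuous (wave m th).
Proof.
apply: continuous_cos_comp; apply: continuous_addr; last exact: continuous_cstr.
exact: continuous_phase.
Qed.

Lemma norm_wave_le m th x : `|wave m th x| <= 1.
Proof. by rewrite ler_norml cos_geN1 cos_le1. Qed.

Lemma sin_wave m x : sin (phase m x) = wave m (- (pi / 2)) x.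
Proof. by rewrite /wave cosB cos_pihalf sin_pihalf mulr0 add0r mulr1. Qed.

Lemma cos_wave m x : cos (phase m x) = wave m 0 x.
Proof. by rewrite /wave addr0. Qed.

Lemma waveM m m' th th' x : wave m th x * wave m' th' x =
  2^-1 * (wave (m + m') (th + th') x + wave (m - m') (th - th') x).
Proof.
rewrite /wave phaseDl phaseDl phaseN.
rewrite (_ : phase m x + phase m' x + _ = (phase m x + th) + (phase m' x + th')); last by ring.
rewrite (_ : phase m x - phase m' x + _ = (phase m x + th) - (phase m' x + th')); last by ring.
by move: (phase m x + th) (phase m' x + th') => A B; rewrite cosD cosB; field.
Qed.

Lemma freq_ge0 m : 0 <= freq m.
Proof. by apply: sumr_ge0 => j _; rewrite -expr2 sqr_ge0. Qed.

Lemma freqE m : freq m = \sum_(j < n) (m ord0 j)%:~R ^+ 2.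
Proof. by apply: eq_bigr => j _; rewrite !mxE. Qed.

Lemma coord_sqr_le_freq m j : (m ord0 j)%:~R ^+ 2 <= freq m.
Proof. by rewrite freqE (bigD1 j)//= lerDl sumr_ge0// => i _; exact: sqr_ge0. Qed.

(** Each factor 1 + m_j^2 is at most 1 + |m|^2; hence a decay of order n in
    1 + |m|^2 suffices for absolute summability. *)
Lemma lattice_weight_freq m : (1 + freq m) ^- n <= lattice_weight R m.
Proof.
rewrite /lattice_weight -exprVn -[X in _ ^+ X]card_ord -prodr_const.
apply: ler_prod => j _; have q0 := freq_ge0 m; have := sqr_ge0 ((m ord0 j)%:~R : R).
move=> h; rewrite invr_ge0 addr_ge0//= lef_pV2 ?posrE ?ltr_pwDl//.
by rewrite lerD2l coord_sqr_le_freq.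
Qed.

(** The chain rule along a line, in the difference-quotient form in which
    derivatives within a domain are expressed. *)
Lemma cvg_line (f : R -> R) (A B df : R) : is_derive A (1 : R) f df ->
  s^-1 * (f (A + s * B) - f A) @[s --> 0^'] --> B * df.
Proof.
move=> Hf.
have Hl : is_derive (0 : R) (1 : R) (fun s => A + s * B) B.
  apply: (is_derive_withinT (1 : R^o) (fun s => A + s * B) (fun=> B)).1 => x _.
  apply: cvg_near_cst; apply: cvg_within; near=> s.
  have s0 : s != 0 by near: s; exact: nbhs_dnbhs_neq.
  by rewrite [_ *: _]mulr1; field.
have Hf' : is_derive (A + 0 * B) (1 : R) f df by rewrite mul0r addr0.
have := (@is_derive1_comp _ f (fun s => A + s * B) 0 _ _ Hf' Hl).
case=> /cvg_ex[l hl]; rewrite /derive (cvg_lim (@Rhausdorff R) hl) => lE.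
have : l = B * df by rewrite lE mulrC.
move=> <-; apply: (cvg_trans _ hl); apply: near_eq_cvg; apply: nearW => s /=.
by rewrite mul0r !addr0 [_%:A]mulr1.
Unshelve. all: by end_near. Qed.

End Waves.

(** * Iterated derivatives *)

Section CrWithin.
Variables (R : realType) (V : normedModType R).
Implicit Types (E D : set V) (h k : V -> R).

Lemma is_derive_withinD D v h1 h2 k1 k2 :
  is_derive_within D v h1 k1 -> is_derive_within D v h2 k2 ->
  is_derive_within D v (fun x => h1 x + h2 x) (fun x => k1 x + k2 x).
Proof.
move=> d1 d2 x Dx.
rewrite (_ : (fun s : R => _) = fun s : R =>
  s^-1 * (h1 (x + s *: v) - h1 x) + s^-1 * (h2 (x + s *: v) - h2 x)).
  by apply: cvgD; [exact: d1|exact: d2].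
by apply/funext => s; ring.
Qed.

Lemma is_derive_withinZ D v c h k : is_derive_within D v h k ->
  is_derive_within D v (fun x => c * h x) (fun x => c * k x).
Proof.
move=> d x Dx.
rewrite (_ : (fun s : R => _) = fun s : R => c * (s^-1 * (h (x + s *: v) - h x))).
  by apply: cvgMr; exact: d.
by apply/funext => s; ring.
Qed.

Lemma Cr_withinD r E D h1 h2 : Cr_within r E D h1 -> Cr_within r E D h2 ->
  Cr_within r E D (fun x => h1 x + h2 x).
Proof.
elim: r h1 h2 => [|r IH] h1 h2 [c1 d1] [c2 d2]; split => //.
- exact: (@continuous_addr _ (subspace D)).
- exact: (@continuous_addr _ (subspace D)).
move=> v Ev; have [k1 d1k C1] := d1 v Ev; have [k2 d2k C2] := d2 v Ev.
by exists (fun x => k1 x + k2 x); [exact: is_derive_withinD|exact: IH].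
Qed.

Lemma Cr_withinZ r E D c h : Cr_within r E D h ->
  Cr_within r E D (fun x => c * h x).
Proof.
elim: r h => [|r IH] h [ch dh]; split => //.
- by apply: (@continuous_mulr _ (subspace D)) => //; exact: continuous_cstr.
- by apply: (@continuous_mulr _ (subspace D)) => //; exact: continuous_cstr.
move=> v Ev; have [k dk Ck] := dh v Ev.
by exists (fun x => c * k x); [exact: is_derive_withinZ|exact: IH].
Qed.

Lemma Cr_within_cst r E D c : Cr_within r E D (fun=> c).
Proof.
elim: r c => [|r IH] c; split => //; first exact: (@continuous_cstr _ (subspace D)).
  exact: (@continuous_cstr _ (subspace D)).
move=> v Ev; exists (fun=> 0) => // x Dx.
by under eq_fun do rewrite subrr mulr0; exact: cvg_cst.
Qed.

Lemma Cr_within_sum r E D (J : Type) (s : seq J) (h : J -> V -> R) :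
  (forall j, Cr_within r E D (h j)) ->
  Cr_within r E D (fun x => \sum_(j <- s) h j x).
Proof.
move=> Ch; elim: s => [|j s IH].
  by under eq_fun do rewrite big_nil; exact: Cr_within_cst.
by under eq_fun do rewrite big_cons; exact: Cr_withinD.
Qed.

Lemma is_derive_withinT_unique v h k1 k2 :
  is_derive_within setT v h k1 -> is_derive_within setT v h k2 -> k1 = k2.
Proof.
move=> /is_derive_withinT d1 /is_derive_withinT d2; apply/funext => x.
by have [_ <-] := d1 x; have [_ <-] := d2 x.
Qed.

(** The definition gives, for each order, some derivative of that regularity; on
    the whole space derivatives are unique, so one function serves all orders. *)
Lemma smooth_derivative E h v : (forall r, Cr_within r E setT h) -> E v ->
  exists2 k, is_derive_within setT v h k & forall r, Cr_within r E setT k.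
Proof.
move=> sh Ev; have [k dk _] := (sh 1%N).2 v Ev.
exists k => // r; have [k' dk' Ck'] := (sh r.+1).2 v Ev.
by rewrite (is_derive_withinT_unique dk dk').
Qed.

Lemma Cr_within_continuous r E h : Cr_within r E setT h -> continuous h.
Proof.
by case: r => [|r] [ch _]; apply: (continuous_subspace_setT _).2; exact: ch.
Qed.

End CrWithin.

Lemma is_derive_within_lim (R : realType) (V : normedModType R) (D : set V)
    (v : V) (h k : V -> R) :
  (forall x, D x -> s^-1 * (h (x + s *: v) - h x) @[s --> 0^'] --> k x) ->
  is_derive_within D v h k.
Proof.
move=> H x Dx; apply: cvg_trans (H x Dx); apply: cvg_app; exact: cvg_within.
Qed.

(** * Fourier coefficients of smooth periodic functions *)

Section PeriodicIntegrals.
Variables (R : realType) (n : nat) (a w : R).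
Hypotheses (a0 : 0 < a) (wa : `|w| * (2 * a) = 2 * pi).
Implicit Types (r : 'rV[R]_n -> R) (m : 'rV[int]_n).

Local Notation I := (rintegral (box a : set 'rV[R]_n)).
Local Notation E := (@space_dir R n).

Definition rperiodic (L : R) r : Prop :=
  forall j x, r (x + L *: delta_mx ord0 j) = r x.

Let a0' : 0 <= a := ltW a0.

Lemma frequency_neq0 : w != 0.
Proof.
apply/eqP => w0; move: wa; rewrite w0 normr0 mul0r => /esym/eqP.
by rewrite mulf_eq0 (gt_eqF (pi_gt0 R)) pnatr_eq0.
Qed.

Lemma cos_periodic_int k x : cos (x + (2 * pi) * k%:~R) = cos x :> R.
Proof.
have H (N : nat) y : cos (y + 2 * pi * N%:R) = cos y :> R.
  rewrite (_ : 2 * pi * N%:R = pi *+ 2 *+ N); first exact: (periodicn (@cosD2pi R)).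
  by rewrite -[RHS]mulr_natr -[pi *+ 2]mulr_natl.
case: k => M; first exact: H.
by rewrite NegzE intrN mulrN -[LHS](H M.+1) subrK.
Qed.

Lemma wave_periodic m th : rperiodic (2 * a) (wave w m th).
Proof.
move=> j x; rewrite /wave phase_delta addrAC.
have [w0|w0] := lerP 0 w.
  rewrite (_ : 2 * a * _ = 2 * pi * (m ord0 j)%:~R) ?cos_periodic_int//.
  by rewrite -wa ger0_norm//; ring.
rewrite (_ : 2 * a * _ = 2 * pi * (- m ord0 j)%:~R) ?cos_periodic_int//.
by rewrite -wa ltr0_norm// intrN; ring.
Qed.

Lemma is_derive_wave m th j : is_derive_within setT (delta_mx ord0 j)
  (wave w m th) (fun x => - (w * (m ord0 j)%:~R * wave w m (th - pi / 2) x)).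
Proof.
apply: is_derive_within_lim => x _.
rewrite /wave addrA cosBpihalf -mulrN.
under eq_fun do rewrite phase_delta addrAC.
exact: cvg_line.
Qed.

(** The total derivative of [r] times a wave integrates to zero over a period. *)
Lemma rintegral_by_parts r r' m th j : continuous r -> continuous r' ->
  is_derive_within setT (delta_mx ord0 j) r r' -> rperiodic (2 * a) r ->
  I (fun x => r' x * wave w m th x) =
  w * (m ord0 j)%:~R * I (fun x => r x * wave w m (th - pi / 2) x).
Proof.
move=> cr cr' /is_derive_withinT dr pr.
have cw := @continuous_wave R n w m.
have c1 : continuous (fun x => r' x * wave w m th x) by exact: continuous_mulr.
have c2 : continuous (fun x => r x * wave w m (th - pi / 2) x) by exact: continuous_mulr.
have c3 : continuous (fun x => - (w * (m ord0 j)%:~R) * (r x * wave w m (th - pi / 2) x)).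
  by apply: continuous_mulr => //; exact: continuous_cstr.
have : I (fun x => r' x * wave w m th x +
   - (w * (m ord0 j)%:~R) * (r x * wave w m (th - pi / 2) x)) = 0.
  apply: (@rintegral_partial0 _ _ _ j (fun x => r x * wave w m th x)) => //.
  - exact: continuous_addr.
  - apply/is_derive_withinT => x.
    have /is_derive_withinT/(_ x) dw := @is_derive_wave m th j.
    have := dr x => drx.
    apply: (is_derive_eq (is_deriveM drx dw)).
    by rewrite /GRing.scale/=; ring.
  - by move=> x; rewrite pr wave_periodic.
rewrite rintegralD// rintegralZ//; lra.
Qed.

Lemma wave_half_turn m th x : wave w m (th - pi / 2 - pi / 2) x = - wave w m th x.
Proof. by rewrite /wave !addrA cosBpihalf sinBpihalf. Qed.

(** Two integrations by parts turn the phase by pi, that is, change the sign. *)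
Lemma rintegral_wave_derive2 r r1 r2 m th j :
  continuous r -> continuous r1 -> continuous r2 ->
  is_derive_within setT (delta_mx ord0 j) r r1 ->
  is_derive_within setT (delta_mx ord0 j) r1 r2 ->
  rperiodic (2 * a) r -> rperiodic (2 * a) r1 ->
  I (fun x => r2 x * wave w m th x) =
  - (w ^+ 2 * (m ord0 j)%:~R ^+ 2) * I (fun x => r x * wave w m th x).
Proof.
move=> cr c1 c2 d1 d2 pr p1.
rewrite (rintegral_by_parts m th c1 c2 d2 p1) (rintegral_by_parts m _ cr c1 d1 pr).
under [fun x => r x * wave w m (_ - _ - _) x]eq_fun do rewrite wave_half_turn mulrN -mulN1r.
rewrite rintegralZ//; first by ring.
by apply: continuous_mulr => //; exact: continuous_wave.
Qed.

(** Integrating the constant 1 by parts against a wave of non-zero frequency. *)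
Lemma rintegral_wave m th : m != 0 -> I (wave w m th) = 0.
Proof.
move=> m0.
have [j mj] : exists j, m ord0 j != 0.
  apply/existsP; apply: contraNT m0 => /existsPn mj; apply/eqP/rowP => j.
  by have := mj j; rewrite mxE negbK => /eqP.
have c1 : continuous (fun _ : 'rV[R]_n => 1 : R) by exact: continuous_cstr.
have c0 : continuous (fun _ : 'rV[R]_n => 0 : R) by exact: continuous_cstr.
have := @rintegral_by_parts (fun=> 1) (fun=> 0) m (th + pi / 2) j c1 c0.
have -> : (fun x => 0 * wave w m (th + pi / 2) x) = fun=> 0.
  by apply/funext => x; rewrite mul0r.
have -> : (fun x => 1 * wave w m (th + pi / 2 - pi / 2) x) = wave w m th.
  by apply/funext => x; rewrite addrK mul1r.
rewrite rintegral_cst// mul0r => H.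
have d1 : is_derive_within setT (delta_mx ord0 j) (fun _ : 'rV[R]_n => 1 : R) (fun=> 0).
  by apply: is_derive_within_lim => x _; under eq_fun do rewrite subrr mulr0; exact: cvg_cst.
have /esym/eqP := H d1 (fun _ _ => erefl).
by rewrite !mulf_eq0 (negbTE frequency_neq0) intr_eq0 (negbTE mj)/= => /eqP.
Qed.

End PeriodicIntegrals.

Lemma rintegral_sum (R : realType) n (a : R) (J : Type) (s : seq J)
    (h : J -> 'rV[R]_n -> R) : 0 <= a -> (forall j, continuous (h j)) ->
  rintegral (box a) (fun x => \sum_(j <- s) h j x) =
  \sum_(j <- s) rintegral (box a) (h j).
Proof.
move=> a0 ch; elim: s => [|j s IH].
  under eq_fun do rewrite big_nil.
  by rewrite rintegral_cst// mul0r big_nil.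
under eq_fun do rewrite big_cons.
by rewrite rintegralD// ?IH ?big_cons//; exact: continuous_sumr.
Qed.

Lemma rperiodic_derivative (R : realType) n (L : R) (r r1 : 'rV[R]_n -> R) v :
  rperiodic L r -> is_derive_within setT v r r1 -> rperiodic L r1.
Proof.
move=> pr dr j x.
have : is_derive_within setT v r (fun x => r1 (x + L *: delta_mx ord0 j)).
  move=> y _; have := dr (y + L *: delta_mx ord0 j) I.
  rewrite (_ : (fun s : R => _) = fun s : R => s^-1 * (r (y + s *: v) - r y)); first exact.
  by apply/funext => s; rewrite addrAC !pr.
by move=> /(is_derive_withinT_unique dr)/(congr1 (fun f => f x)).
Qed.

Section FourierDecay.
Variables (R : realType) (n : nat) (a w : R).
Hypotheses (a0 : 0 < a) (wa : `|w| * (2 * a) = 2 * pi).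
Implicit Types (r : 'rV[R]_n -> R) (m : 'rV[int]_n).

Local Notation I := (rintegral (box a : set 'rV[R]_n)).
Local Notation E := (@space_dir R n).

(** The operator 1 - Laplacian / w^2 multiplies the Fourier coefficients by
    1 + |m|^2 and keeps the function smooth and periodic; iterating it [N] times
    and bounding the last integral trivially gives the decay. *)
Lemma fourier_decay r N : (forall k, Cr_within k E setT r) ->
  rperiodic (2 * a) r ->
  exists C, forall m th, (1 + freq R m) ^+ N * `|I (fun x => r x * wave w m th x)| <= C.
Proof.
have a0' := ltW a0.
elim: N r => [|N IH] r sr pr.
  have cr := Cr_within_continuous (sr 0%N).
  have [M M0 HM] := continuous_bounded_box a cr.
  exists (M * (2 * a) ^+ n) => m th; rewrite expr0 mul1r.
  apply: norm_rintegral_le => //.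
    by apply: continuous_mulr => //; exact: continuous_wave.
  move=> x bx; rewrite normrM -[leRHS]mulr1 ler_pM ?HM//; exact: norm_wave_le.
have /choice[r1 Hr1] (j : 'I_n) : exists k, is_derive_within setT (delta_mx ord0 j) r k
    /\ forall i, Cr_within i E setT k.
  have [|k] := smooth_derivative (v := delta_mx ord0 j) sr; first by exists j.
  by exists k.
have /choice[r2 Hr2] (j : 'I_n) : exists k, is_derive_within setT (delta_mx ord0 j) (r1 j) k
    /\ forall i, Cr_within i E setT k.
  have [|k] := smooth_derivative (v := delta_mx ord0 j) (Hr1 j).2; first by exists j.
  by exists k.
(* D r = r - (Laplacian of r) / w^2 *)
pose D x := r x + - w ^- 2 * \sum_(j < n) r2 j x.
have sD k : Cr_within k E setT D.
  apply: Cr_withinD; first exact: sr.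
  by apply: Cr_withinZ; apply: Cr_within_sum => j; exact: (Hr2 j).2.
have p1 j : rperiodic (2 * a) (r1 j) by exact: rperiodic_derivative pr (Hr1 j).1.
have p2 j : rperiodic (2 * a) (r2 j) by exact: rperiodic_derivative (p1 j) (Hr2 j).1.
have pD : rperiodic (2 * a) D.
  by move=> j x; rewrite /D pr; under eq_bigr do rewrite p2.
have [C HC] := IH D sD pD.
exists C => m th.
have cr := Cr_within_continuous (sr 0%N).
have c1 j := Cr_within_continuous ((Hr1 j).2 0%N).
have c2 j := Cr_within_continuous ((Hr2 j).2 0%N).
have cw := @continuous_wave R n w m th.
suff -> : (1 + freq R m) ^+ N.+1 * `|I (fun x => r x * wave w m th x)| =
   (1 + freq R m) ^+ N * `|I (fun x => D x * wave w m th x)| by exact: HC.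
rewrite exprSr -mulrA; congr (_ * _).
rewrite -[X in X * _]ger0_norm ?addr_ge0 ?freq_ge0// -normrM; congr (`| _ |).
rewrite (_ : (fun x => D x * _) = fun x => r x * wave w m th x +
  - w ^- 2 * \sum_(j < n) (r2 j x * wave w m th x)); last first.
  by apply/funext => x; rewrite /D mulrDl -mulrA mulr_suml.
have crw : continuous (fun x => r x * wave w m th x) by exact: continuous_mulr.
have crw2 j : continuous (fun x => r2 j x * wave w m th x) by exact: continuous_mulr.
have csum : continuous (fun x => \sum_(j < n) (r2 j x * wave w m th x)) by exact: continuous_sumr.
rewrite rintegralD//; last by apply: continuous_mulr => //; exact: continuous_cstr.
rewrite rintegralZ// rintegral_sum//.
have w0 := frequency_neq0 wa.
rewrite (eq_bigr (fun j => - w ^+ 2 * (m ord0 j)%:~R ^+ 2 * I (fun x => r x * wave w m th x))).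
  by rewrite -mulr_suml -mulr_sumr -freqE; field.
move=> j _; rewrite mulNr.
exact: (rintegral_wave_derive2 a0 wa m th cr (c1 j) (c2 j) (Hr1 j).1 (Hr2 j).1 pr (p1 j)).
Qed.

End FourierDecay.

(** * Uniqueness of Fourier coefficients *)

(** A positive lower bound on a small cube forces a positive lower bound on the
    integral; this is where the kernels [T ^+ N] below are seen to grow. *)
Lemma rintegral_ge_cube (R : realType) n (a c e : R) (h : 'rV[R]_n -> R) (x : 'rV[R]_n) :
  0 <= a -> 0 < e -> 0 <= c -> continuous h ->
  (forall y, box a y -> 0 <= h y) ->
  (forall y : 'rV[R]_n, (forall j, `|y ord0 j - x ord0 j| <= e) -> box a y /\ c <= h y) ->
  c * (2 * e) ^+ n <= rintegral (box a) h.
Proof.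
move=> a0 e0 c0 ch h0 hc.
(* The coordinates of x, extended by 0 to all natural indices. *)
pose z (i : nat) : R := oapp (x ord0) 0 (insub i).
have zE (j : 'I_n) : z j = x ord0 j by rewrite /z valK.
have [mP muP] := @lebesgue_space_prod R n (fun i => `[z i - e, z i + e]%classic)
  (fun=> measurable_itv _).
set P := [set u | _] in mP muP.
have muP' : sms_meas (lebesgue_space R n) P = ((2 * e) ^+ n)%:E.
  rewrite muP (eq_bigr (fun=> (2 * e)%:E)).
    by rewrite prodEFin prodr_const card_ord.
  move=> i _; rewrite lebesgue_measure_itv /= lte_fin ifT; last by lra.
  by rewrite -EFinB; congr (_%:E); lra.
have hP u : P u -> box a (lebesgue_point u) /\ c <= h (lebesgue_point u).
  move=> Pu; apply: hc => j; have := Pu j; rewrite /= in_itv/= zE mxE ler_norml; lra.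
have fin := integrable_fin_num (measurable_box n a) (integrable_box a0 ch).
rewrite -lee_fin /rintegral /Rintegral fineK//.
apply: (@le_trans _ _ (\int[sms_meas (lebesgue_space R n)]_(u in P) (h (lebesgue_point u))%:E)%E).
  apply: (@le_trans _ _ (\int[sms_meas (lebesgue_space R n)]_(u in P) c%:E)%E).
    rewrite integral_cst//= EFinM; apply: lee_wpmul2l; first by rewrite lee_fin.
    by rewrite -muP'.
  apply: ge0_le_integral => //.
  - exact/measurable_realfun.measurable_EFinP/measurable_funTS/continuous_lebesgue_point_measurable.
  - by move=> u Pu; rewrite lee_fin; exact: (hP u Pu).2.
apply: ge0_subset_integral => //.
- exact: measurable_box.
- exact/measurable_realfun.measurable_EFinP/measurable_funTS/continuous_lebesgue_point_measurable.
- by move=> u bu; rewrite lee_fin; exact: h0.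
- by move=> u Pu; exact: (hP u Pu).1.
Qed.
Lemma cos_lt1 (R : realType) (u : R) : `|u| < 2 * pi -> u != 0 -> cos u < 1.
Proof.
move=> u2 u0; rewrite -cos_norm; move: u2 u0; rewrite -normr_gt0.
move: `|u| => v v2 v0.
have -> : v = (v / 2) *+ 2 by rewrite -mulr_natr divfK.
have : 0 < sin (v / 2) by apply: sin_gt0_pi; lra.
rewrite cos_mulr2n cos2sin2 mulr2n => h.
have : 0 < sin (v / 2) ^+ 2 by exact: exprn_gt0.
lra.
Qed.

Section FourierUniqueness.
Variables (R : realType) (n : nat) (a w : R).
Hypotheses (a0 : 0 < a) (wa : `|w| * (2 * a) = 2 * pi).
Implicit Types (r : 'rV[R]_n -> R) (m : 'rV[int]_n).

Local Notation I := (rintegral (box a : set 'rV[R]_n)).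

Let a0' : 0 <= a := ltW a0.

Definition wave_orthogonal r := forall m th, I (fun x => r x * wave w m th x) = 0.

(** A factor cos (w (y_j - x_j)) is itself a wave, and a product of waves is a sum
    of waves; so orthogonality to waves survives multiplication by a trigonometric
    polynomial of this shape. *)
Lemma wave_orthogonal_mul r A B (x : 'rV[R]_n) : continuous r ->
  wave_orthogonal r ->
  wave_orthogonal (fun y => r y * (A + B * \sum_(j < n) cos (w * (y ord0 j - x ord0 j)))).
Proof.
move=> cr r0 m th.
have crw m' th' : continuous (fun y => r y * wave w m' th' y).
  by apply: continuous_mulr => //; exact: continuous_wave.
pose q j y := 2^-1 * (r y * wave w (m + delta_mx ord0 j) (th - w * x ord0 j) y) +
  2^-1 * (r y * wave w (m - delta_mx ord0 j) (th + w * x ord0 j) y).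
have cq j : continuous (q j).
  by apply: continuous_addr; apply: continuous_mulr => //; exact: continuous_cstr.
rewrite (_ : (fun y => _) = fun y => A * (r y * wave w m th y) + B * \sum_(j < n) q j y).
  rewrite rintegralD//; [|exact: continuous_mulr (@continuous_cstr _ _ _) _|]; last first.
    by apply: continuous_mulr; [exact: continuous_cstr|exact: continuous_sumr].
  rewrite !rintegralZ//; last exact: continuous_sumr.
  rewrite rintegral_sum// r0 mulr0 add0r big1 ?mulr0// => j _.
  rewrite rintegralD//; try by apply: continuous_mulr => //; exact: continuous_cstr.
  by rewrite !rintegralZ// !r0 !mulr0 addr0.
apply/funext => y.
rewrite mulrDr mulrDl; congr (_ + _); first by ring.
rewrite mulrCA -mulrA; congr (_ * _).
rewrite mulr_sumr mulr_suml; apply: eq_bigr => j _; rewrite /q.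
rewrite (_ : cos _ = wave w (delta_mx ord0 j) (- (w * x ord0 j)) y); last first.
  by rewrite /wave phase_unit mulrBr.
rewrite -mulrA [wave w (delta_mx _ _) _ y * _]mulrC waveM opprK; ring.
Qed.

Lemma wave_orthogonal_exp r A B (x : 'rV[R]_n) N : continuous r ->
  wave_orthogonal r ->
  let T (y : 'rV[R]_n) := A + B * \sum_(j < n) cos (w * (y ord0 j - x ord0 j)) in
  I (fun y => r y * T y ^+ N) = 0.
Proof.
move=> cr r0 T.
have cT : continuous T.
  apply: continuous_addr; first exact: continuous_cstr.
  apply: continuous_mulr; first exact: continuous_cstr.
  apply: continuous_sumr => j; apply: continuous_cos_comp.
  apply: continuous_mulr; first exact: continuous_cstr.
  apply: continuous_addr; [exact: continuous_coord|exact: continuous_cstr].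
have H : wave_orthogonal (fun y => r y * T y ^+ N).
  elim: N => [|N IH]; first by under eq_fun do rewrite expr0 mulr1.
  under eq_fun do rewrite exprSr mulrA.
  apply: wave_orthogonal_mul => //.
  by apply: continuous_mulr => //; exact: continuous_exprn.
rewrite -[RHS](H 0 0); congr (I _); apply/funext => y.
by rewrite /wave phase0 addr0 cos0 mulr1.
Qed.

(** The classical peaking argument. If r(x) > 0, choose
    T = 1 + e + d * sum_j (cos (w (y_j - x_j)) - 1) with small d, e > 0 so that
    0 <= T, that T <= 1 wherever r <= r(x)/2, and that T(x) = 1 + e. Then r T^N
    integrates to 0, while its integral exceeds a constant times that of T^N minus a
    bounded quantity, and the integral of T^N grows geometrically. The point [x] is
    interior so that T < 1 + e at every other point of the box. *)
Lemma wave_orthogonal_le0 r (x : 'rV[R]_n) : continuous r ->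
  wave_orthogonal r -> (forall j, `|x ord0 j| < a) -> r x <= 0.
Proof.
move=> cr r0 xa; rewrite leNgt; apply/negP => rx.
pose c (y : 'rV[R]_n) : R := \sum_(j < n) (cos (w * (y ord0 j - x ord0 j)) - 1).
have cc : continuous c.
  apply: continuous_sumr => j; apply: continuous_addr; last exact: continuous_cstr.
  apply: continuous_cos_comp; apply: continuous_mulr; first exact: continuous_cstr.
  apply: continuous_addr; [exact: continuous_coord|exact: continuous_cstr].
have c_ge y : - (2 * n%:R) <= c y.
  rewrite (_ : - _ = \sum_(j < n) (- 2)); last first.
    by rewrite sumr_const card_ord -[RHS]mulr_natr mulNr.
  apply: ler_sum => j _.
  by have := cos_geN1 (w * (y ord0 j - x ord0 j)); lra.
have w0 := frequency_neq0 wa.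
have c_lt0 y : box a y -> y != x -> c y < 0.
  move=> ya yx.
  have [j yxj] : exists j, y ord0 j != x ord0 j.
    apply/existsP; apply: contraNT yx => /existsPn h; apply/eqP/rowP => j.
    by have := h j; rewrite negbK => /eqP.
  rewrite /c (bigD1 j)//= -[ltRHS](addr0 0); apply: ltr_leD.
    rewrite subr_lt0; apply: cos_lt1; last by rewrite mulf_neq0// subr_eq0.
    rewrite normrM -wa ltr_pM2l ?normr_gt0//.
    have := ya j; have := xa j; rewrite ltr_norml ler_norml ltr_norml; lra.
  by apply: sumr_le0 => i _; rewrite subr_le0 cos_le1.
pose K := [set y | box a y /\ r y <= r x / 2].
(* On the compact set K the function c is negative, since K avoids x; k bounds it
   away from 0. *)
have [k k0 Hk] : exists2 k, 0 < k & forall y, K y -> c y <= - k.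
  have [->|K0] := eqVneq K set0; first by exists 1.
  have cK : compact K.
    apply: (@subclosed_compact _ K (box a)) => //; last by move=> y [].
    - apply: closedI; first exact: compact_closed (@compact_box _ _ _).
      exact: (closed_comp (fun y _ => cr y) (@closed_le R (r x / 2))).
    - exact: compact_box.
  have /set0P/(EVT_max_rV)/(_ cK (continuous_subspaceT cc))[y /set_mem Ky Hy] := K0.
  exists (- c y); last by move=> z Kz; rewrite opprK; apply: Hy; exact: mem_set.
  rewrite oppr_gt0; apply: c_lt0; first exact: Ky.1.
  by apply/eqP => yx; have := Ky.2; rewrite yx; lra.
(* d is small enough for T to be non-negative: c >= - 2 n. *)
pose d : R := (2 * n%:R + 1)^-1.
have n0 : 0 <= n%:R :> R by [].
have d0 : 0 < d by rewrite invr_gt0; lra.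
pose e := d * k.
have e0 : 0 < e by rewrite mulr_gt0.
pose T (y : 'rV[R]_n) := 1 + e - d * n%:R + d * \sum_(j < n) cos (w * (y ord0 j - x ord0 j)).
have TE y : T y = 1 + e + d * c y.
  rewrite /T /c sumrB sumr_const card_ord; ring.
have cT : continuous T.
  rewrite (_ : T = fun y => 1 + e + d * c y); last exact/funext.
  apply: continuous_addr; first exact: continuous_cstr.
  by apply: continuous_mulr => //; exact: continuous_cstr.
have T_ge0 y : 0 <= T y.
  rewrite TE; have : d * (- (2 * n%:R)) <= d * c y by rewrite ler_pM2l.
  have : d * (2 * n%:R + 1) = 1 by rewrite mulVf//; lra.
  by rewrite mulrDr mulr1 mulrN; move: (d * (2 * _)) (d * c y) => X Y; lra.
have T_le1 y : K y -> T y <= 1.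
  move=> /Hk ck; rewrite TE /e.
  have : d * c y <= d * - k by rewrite ler_pM2l.
  lra.
have [M M0 HM] := continuous_bounded_box a cr.
pose B := M + r x / 2.
have cTN N : continuous (fun y => T y ^+ N) by exact: continuous_exprn.
(* Pointwise r T^N + B >= (r x / 2) T^N: off K because r > r x / 2, and on K
   because 0 <= T^N <= 1 and r >= - M. *)
have intT N : r x / 2 * I (fun y => T y ^+ N) <= B * (2 * a) ^+ n.
  have crT : continuous (fun y => r y * T y ^+ N) by exact: continuous_mulr.
  rewrite -rintegralZ// -(rintegral_cst n a0').
  have <- : I (fun y => r y * T y ^+ N + B) = I (fun=> B).
    rewrite rintegralD//; last exact: continuous_cstr.
    by rewrite (@wave_orthogonal_exp r _ _ x N cr r0) add0r.
  apply: le_rintegral => //.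
  - by apply: continuous_mulr => //; exact: continuous_cstr.
  - by apply: continuous_addr => //; exact: continuous_cstr.
  move=> y ya; have TN0 : 0 <= T y ^+ N by exact: exprn_ge0.
  have [ry|ry] := lerP (r y) (r x / 2); last 
    by have : 0 <= (r y - r x / 2) * T y ^+ N by [rewrite mulr_ge0//; lra]; rewrite /B; lra.
  have TN1 : T y ^+ N <= 1 by apply: exprn_ile1 => //; exact: T_le1.
  have := HM y ya; rewrite ler_norml /B => /andP[ryM _].
  have : (M + r x / 2) * T y ^+ N <= (M + r x / 2) * 1 by rewrite ler_wpM2l//; lra.
  have : (- M) * T y ^+ N <= r y * T y ^+ N by rewrite ler_wpM2r.
  lra.
have [e1 /= e10 He1] : nbhs_ball x [set y | 1 + e / 2 < T y /\ forall j, `|y ord0 j| < a].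
  apply/nbhs_ballP; apply: filterI.
    have Tx : 1 + e / 2 < T x.
      rewrite TE /c big1 ?mulr0; first by lra.
      by move=> j _; rewrite subrr mulr0 cos0 subrr.
    exact: (cT x _ (lt_nbhsr Tx)).
  apply: (@filter_forall _ _ (fun (j : 'I_n) (y : 'rV[R]_n) => `|y ord0 j| < a) _ (nbhs_filter x)) => j.
  have cj : continuous (fun y : 'rV[R]_n => `|y ord0 j|).
    by move=> y; exact: (cvg_norm (@continuous_coord R n j y)).
  exact: (cj x _ (lt_nbhsl (xa j))).
pose h := e1 / 2.
have h0 : 0 < h by rewrite divr_gt0.
have lowT N : (1 + e / 2) ^+ N * (2 * h) ^+ n <= I (fun y => T y ^+ N).
  apply: (@rintegral_ge_cube _ _ _ _ _ _ x) => //.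
  - by apply: exprn_ge0; lra.
  - by move=> y _; exact: exprn_ge0.
  move=> y yh; have [|T1 ya] := He1 y.
    split => // i j; rewrite ord1 -ball_normE /= distrC.
    by apply: le_lt_trans (yh j) _; rewrite /h; lra.
  split; first by move=> j; exact: ltW.
  by apply: lerXn2r; rewrite ?nnegrE//; lra.
(* Bernoulli, so that the integrals of T^N are unbounded. *)
have bern N : 1 + N%:R * (e / 2) <= (1 + e / 2) ^+ N.
  elim: N => [|N IH]; first by rewrite mul0r addr0 expr0.
  rewrite exprS -natr1.
  have : (1 + e / 2) * (1 + N%:R * (e / 2)) <= (1 + e / 2) * (1 + e / 2) ^+ N.
    by rewrite ler_pM2l//; lra.
  have : 0 <= N%:R * (e / 2) * (e / 2) by rewrite !mulr_ge0//; lra.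
  move: (_ ^+ N) (N%:R : R) => X Y; lra.
pose V := r x / 2 * (2 * h) ^+ n.
have V0 : 0 < V by rewrite mulr_gt0 ?exprn_gt0//; lra.
have Ve0 : 0 < V * (e / 2) by rewrite mulr_gt0//; lra.
have bound N : V * (e / 2) * N%:R <= B * (2 * a) ^+ n.
  apply: le_trans (intT N); rewrite -mulrA /V -mulrA ler_pM2l; last lra.
  apply: le_trans (lowT N); rewrite mulrC ler_pM2r ?exprn_gt0//; last by lra.
  by apply: le_trans (bern N); rewrite mulrC; lra.
have := bound (Num.truncn (B * (2 * a) ^+ n / (V * (e / 2)))).+1.
by rewrite -ler_pdivlMl// mulrC leNgt truncnS_gt.
Qed.

Lemma wave_orthogonal_eq0 r (x : 'rV[R]_n) : continuous r ->
  wave_orthogonal r -> (forall j, `|x ord0 j| < a) -> r x = 0.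
Proof.
move=> cr r0 xa; apply/eqP; rewrite eq_le wave_orthogonal_le0//=.
rewrite -oppr_le0; apply: (@wave_orthogonal_le0 (fun y => - r y)) => //.
  exact: continuous_oppr.
move=> m th.
under eq_fun do rewrite mulNr -mulN1r.
rewrite rintegralZ//; last first.
  by apply: continuous_mulr => //; exact: continuous_wave.
by rewrite r0 mulr0.
Qed.

(** The boundary points of the box are limits of interior points. *)
Lemma wave_orthogonal_eq0_box r (x : 'rV[R]_n) : continuous r ->
  wave_orthogonal r -> box a x -> r x = 0.
Proof.
move=> cr r0 xa.
have cs : continuous (fun s : R => (1 - s) *: x : 'rV[R]_n).
  move=> s; apply: cvgZl; apply: cvgB; [exact: cvg_cst|exact: cvg_id].
have : r ((1 - s) *: x) @[s --> 0^'+] --> r x.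
  rewrite -[in X in _ --> X](scale1r x) -{2}(subr0 1).
  apply: cvg_at_right_filter.
  exact: (@continuous_comp _ _ _ (fun s : R => (1 - s) *: x : 'rV[R]_n) r 0 (cs 0) (cr _)).
move/(cvg_lim (@Rhausdorff R)) => <-.
apply: (cvg_lim (@Rhausdorff R)); apply: cvg_near_cst; near=> s.
have s0 : 0 < s by [].
have s1 : s < 1 by near: s; exact: nbhs_right_lt.
apply: wave_orthogonal_eq0 => // j; rewrite mxE normrM gtr0_norm; last lra.
apply: (@le_lt_trans _ _ ((1 - s) * a)); first by rewrite ler_wpM2l ?xa//; lra.
by have : 0 < s * a by [rewrite mulr_gt0]; lra.
Unshelve. all: by end_near. Qed.

End FourierUniqueness.

(** * Rapidly decreasing coefficients *)

Section RapidDecay.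
Variables (R : realType) (n : nat).
Implicit Types (u v p : 'rV[int]_n -> R).

(** Faster decay than any power of 1 + |m|^2: the coefficients of smooth functions,
    and the class that is stable under all the multipliers produced by
    differentiation. *)
Definition rapid u := forall N, exists C, forall m, (1 + freq R m) ^+ N * `|u m| <= C.

Lemma freq1_ge1 (m : 'rV[int]_n) : 1 <= 1 + freq R m.
Proof. by rewrite lerDl freq_ge0. Qed.

Lemma freq1_gt0 (m : 'rV[int]_n) : 0 < 1 + freq R m.
Proof. exact: lt_le_trans (freq1_ge1 m). Qed.

Lemma rapid_abs_summable u : rapid u -> abs_summable u.
Proof.
move=> /(_ n)[C HC].
apply: abs_summable_le (abs_summableZ `|C| (abs_summable_lattice_weight R n)) => m.
rewrite normrM normr_id.
have q0 := freq1_gt0 m.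
have h : `|u m| <= C * (1 + freq R m) ^- n.
  by rewrite ler_pdivlMr ?exprn_gt0// mulrC.
apply: le_trans h _; apply: (@le_trans _ _ (`|C| * (1 + freq R m) ^- n)).
  by rewrite ler_wpM2r ?ler_norm// invr_ge0 exprn_ge0// ltW.
rewrite ler_wpM2l//; apply: le_trans (lattice_weight_freq R m) _; exact: ler_norm.
Qed.

Lemma rapid_mul p K u : rapid u -> (forall m, `|p m| <= K * (1 + freq R m)) ->
  rapid (fun m => p m * u m).
Proof.
move=> ru pK N; have [C HC] := ru N.+1; exists (K * C) => m.
have q0 := freq1_gt0 m.
have K0 : 0 <= K by rewrite -(pmulr_lge0 _ q0); exact: le_trans (pK m).
rewrite normrM; apply: le_trans (ler_wpM2l K0 (HC m)).
have -> : K * ((1 + freq R m) ^+ N.+1 * `|u m|) =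
    (1 + freq R m) ^+ N * (K * (1 + freq R m) * `|u m|) by rewrite exprSr; ring.
rewrite ler_wpM2l ?ler_wpM2r//; exact/exprn_ge0/ltW.
Qed.

Lemma rapidD u v : rapid u -> rapid v -> rapid (fun m => u m + v m).
Proof.
move=> ru rv N; have [C HC] := ru N; have [C' HC'] := rv N.
exists (C + C') => m; apply: le_trans (lerD (HC m) (HC' m)).
rewrite -mulrDr ler_wpM2l ?ler_normD// exprn_ge0// ltW//; exact: freq1_gt0.
Qed.

Lemma rapidZ c u : rapid u -> rapid (fun m => c * u m).
Proof.
move=> ru; apply: (@rapid_mul (fun=> c) `|c|) => // m.
by rewrite ler_peMr// freq1_ge1.
Qed.

Lemma rapidN u : rapid u -> rapid (fun m => - u m).
Proof.
move=> ru; rewrite (_ : (fun m => - u m) = fun m => -1 * u m); first exact: rapidZ.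
by apply/funext => m; rewrite mulN1r.
Qed.

End RapidDecay.

(** * Harmonic series on the half-space *)

Section Lipschitz.
Variable R : realType.

Lemma lipschitz1 (f df : R -> R) (x y : R) : (forall z, is_derive z (1 : R) f (df z)) ->
  (forall z, `|df z| <= 1) -> `|f y - f x| <= `|y - x|.
Proof.
move=> fd d1.
have H (a b : R) : a <= b -> `|f b - f a| <= `|b - a|.
  move=> ab; have [|z _ ->] := @MVT_segment _ f df a b ab (fun z _ => fd z).
    apply: continuous_subspaceT => z; apply: differentiable_continuous.
    by apply/derivable1_diffP; case: (fd z).
  by rewrite normrM ler_piMl.
have [xy|yx] := leP x y; first exact: H.
by rewrite distrC [leRHS]distrC; apply: H; exact: ltW.
Qed.

Lemma cos_lipschitz (x y : R) : `|cos y - cos x| <= `|y - x|.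
Proof.
apply: (@lipschitz1 cos (fun z => - sin z)) => z.
by rewrite normrN sin_max.
Qed.

Lemma sin_lipschitz (x y : R) : `|sin y - sin x| <= `|y - x|.
Proof.
by apply: (@lipschitz1 sin cos) => z; exact: cos_max.
Qed.

Lemma expR_lipschitz (x y : R) : x <= 0 -> y <= 0 -> `|expR y - expR x| <= `|y - x|.
Proof.
have H (a b : R) : b <= 0 -> a <= b -> `|expR b - expR a| <= `|b - a|.
  move=> b0 ab; rewrite !ger0_norm ?subr_ge0 ?ler_expR//.
  have h : (1 + (a - b)) * expR b <= expR a.
    by rewrite -{2}(subrK b a) expRD ler_wpM2r ?expR_ge0 ?expR_ge1Dx.
  have : (b - a) * expR b <= (b - a) * 1 by rewrite ler_wpM2l ?subr_ge0// expR_le1.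
  lra.
move=> x0 y0; have [xy|yx] := leP x y; first exact: H.
by rewrite distrC [leRHS]distrC; apply: H => //; exact: ltW.
Qed.

(** The Lipschitz bound in the form of a bound on difference quotients that is
    uniform in the increment [s], also for [s = 0] with the convention 0^-1 = 0. *)
Lemma quotient_le (f : R -> R) (A B s : R) : `|f (A + s * B) - f A| <= `|A + s * B - A| ->
  `|s^-1 * (f (A + s * B) - f A)| <= `|B|.
Proof.
have [->|s0 h] := eqVneq s 0; first by move=> _; rewrite invr0 mul0r normr0.
rewrite normrM normfV ler_pdivrMl ?normr_gt0//.
by apply: le_trans h _; rewrite addrC addKr normrM.
Qed.

End Lipschitz.

Lemma near_within T (F : set_system T) (FF : Filter F) (D P : set T) :
  (forall x, D x -> P x) -> \forall x \near within D F, P x.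
Proof. by move=> DP; apply: filterS (withinT D FF); exact: DP. Qed.

Section HarmonicSeries.
Variables (R : realType) (n : nat) (w : R).
Implicit Types (u v : 'rV[int]_n -> R) (m : 'rV[int]_n) (x : 'rV[R]_n) (t : R).

Definition rate m : R := `|w| * enorm (intvec R m).

(** The general real solution of the Laplace equation with frequency [m] that is
    bounded on the half-space t >= 0. *)
Definition harmonic u v m x t : R :=
  (u m * cos (phase w m x) + v m * sin (phase w m x)) * expR (- (rate m * t)).

Definition hseries u v x t : R := rsum (fun m => harmonic u v m x t).

Lemma rate_ge0 m : 0 <= rate m.
Proof. by rewrite mulr_ge0// sqrtr_ge0. Qed.

Lemma rate_sqr m : rate m ^+ 2 = w ^+ 2 * freq R m.
Proof. by rewrite exprMn real_normK ?num_real// sqr_sqrtr// freq_ge0. Qed.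

Lemma rate_le m : `|rate m| <= `|w| * (1 + freq R m).
Proof.
rewrite ger0_norm ?rate_ge0// ler_wpM2l//.
have q0 := freq_ge0 R m.
rewrite -[leRHS]ger0_norm ?addr_ge0// -sqrtr_sqr ler_wsqrtr// -/(freq R m).
nra.
Qed.

(** The multipliers produced by differentiation grow at most linearly in
    1 + |m|^2, so they preserve rapid decay. *)
Lemma coord_le m j : `|w * (m ord0 j)%:~R| <= `|w| * (1 + freq R m).
Proof.
rewrite normrM ler_wpM2l//; have q0 := freq_ge0 R m.
rewrite -sqrtr_sqr -[leRHS]ger0_norm ?addr_ge0// -sqrtr_sqr ler_wsqrtr//.
have := @coord_sqr_le_freq R n m j; nra.
Qed.

Lemma expR_rate_le1 m t : 0 <= t -> expR (- (rate m * t)) <= 1.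
Proof. by move=> t0; rewrite expR_le1 oppr_le0 mulr_ge0// rate_ge0. Qed.

Lemma cos_sin_le (a b z : R) : `|a * cos z + b * sin z| <= `|a| + `|b|.
Proof.
apply: le_trans (ler_normD _ _) _; rewrite !normrM.
by apply: lerD; rewrite ler_piMr ?cos_max ?sin_max.
Qed.

Lemma harmonic_le u v m x t : 0 <= t -> `|harmonic u v m x t| <= `|u m| + `|v m|.
Proof.
move=> t0; rewrite normrM (ger0_norm (expR_ge0 _)) -[leRHS]mulr1.
by rewrite ler_pM ?expR_ge0 ?cos_sin_le ?expR_rate_le1.
Qed.

Lemma harmonic_bound_summable u v : rapid u -> rapid v ->
  abs_summable (fun m => `|u m| + `|v m|).
Proof.
have H z : rapid z -> abs_summable (fun m => `|z m|).
  by move=> /rapid_abs_summable; apply: abs_summable_le => m; rewrite normr_id.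
by move=> ru rv; apply: abs_summableD; exact: H.
Qed.

Lemma harmonic_summable u v x t : rapid u -> rapid v -> 0 <= t ->
  abs_summable (fun m => harmonic u v m x t).
Proof.
move=> ru rv t0; apply: abs_summable_le (harmonic_bound_summable ru rv) => m.
by rewrite [leRHS]ger0_norm ?addr_ge0// harmonic_le.
Qed.

Lemma continuous_harmonic u v m :
  continuous (fun p : 'rV[R]_n * R => harmonic u v m p.1 p.2).
Proof.
have cf : continuous (fun p : 'rV[R]_n * R => phase w m p.1).
  move=> p; apply: (@continuous_comp _ _ _ fst (phase w m)); first exact: cvg_fst.
  exact: continuous_phase.
have cs : continuous (fun p : 'rV[R]_n * R => p.2) by move=> p; exact: cvg_snd.
apply: continuous_mulr.
  apply: continuous_addr; apply: continuous_mulr; try exact: continuous_cstr.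
    exact: continuous_cos_comp.
  move=> p; apply: (@continuous_comp _ _ _ (fun p => phase w m p.1) sin); first exact: cf.
  exact: continuous_sin.
move=> p; apply: (@continuous_comp _ _ _ (fun p => - (rate m * p.2)) expR); last first.
  exact: continuous_expR.
move: p; apply: continuous_oppr; apply: continuous_mulr => //; exact: continuous_cstr.
Qed.

(** On the closed half-space the terms are dominated by |u m| + |v m|. *)
Lemma hseries_continuous u v : rapid u -> rapid v ->
  {within @closed_halfspace R n, continuous (fun p => hseries u v p.1 p.2)}.
Proof.
move=> ru rv; apply/subspace_continuousP => p p0.
apply: (@cvg_rsum R _ _ (within (@closed_halfspace R n) (nbhs p)) _
  (fun q m => harmonic u v m q.1 q.2) _ _ (harmonic_bound_summable ru rv)).
- by move=> m; exact: harmonic_le.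
- by apply: near_within => q q0 m; exact: harmonic_le.
- by move=> m; apply: cvg_within_filter; exact: continuous_harmonic.
Qed.

(** Term-by-term differentiation within the closed half-space along any
    direction, from a summable bound on the difference quotients of the terms. *)
Lemma hseries_derivative (dir : 'rV[R]_n * R) u v u' v' (b : 'rV[int]_n -> R) :
  rapid u -> rapid v -> abs_summable b ->
  (forall m p, 0 <= p.2 -> `|harmonic u' v' m p.1 p.2| <= b m) ->
  (forall m p s, 0 <= p.2 -> 0 <= (p + s *: dir).2 ->
    `|s^-1 * (harmonic u v m (p + s *: dir).1 (p + s *: dir).2 -
              harmonic u v m p.1 p.2)| <= b m) ->
  (forall m p, 0 <= p.2 ->
    s^-1 * (harmonic u v m (p + s *: dir).1 (p + s *: dir).2 -
            harmonic u v m p.1 p.2) @[s --> 0^'] --> harmonic u' v' m p.1 p.2) ->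
  is_derive_within (@closed_halfspace R n) dir
    (fun p => hseries u v p.1 p.2) (fun p => hseries u' v' p.1 p.2).
Proof.
move=> ru rv sb bl bq ql p p0.
have H : rsum (fun m => s^-1 * (harmonic u v m (p + s *: dir).1 (p + s *: dir).2 -
      harmonic u v m p.1 p.2)) @[s --> within [set s : R |
      closed_halfspace (p + s *: dir)] 0^'] --> hseries u' v' p.1 p.2.
  apply: (@cvg_rsum R _ R (within [set s : R | closed_halfspace (p + s *: dir)] 0^') _
    (fun s m => s^-1 * (harmonic u v m (p + s *: dir).1 (p + s *: dir).2 -
    harmonic u v m p.1 p.2)) _ b sb).
  - by move=> m; exact: bl.
  - by apply: near_within => s ps m; exact: bq.
  - by move=> m; apply: cvg_within_filter; exact: ql.
apply: (cvg_trans _ H); apply: near_eq_cvg; apply: near_within => s ps.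
have s1 := @harmonic_summable u v (p + s *: dir).1 _ ru rv ps.
have s2 := @harmonic_summable u v p.1 _ ru rv p0.
have s3 := abs_summableZ (-1) s2.
rewrite (_ : (fun m => s^-1 * _) = fun m => s^-1 * (harmonic u v m (p + s *: dir).1
    (p + s *: dir).2 + -1 * harmonic u v m p.1 p.2)).
  by rewrite rsumZ ?rsumD ?rsumZ ?mulN1r//; exact: abs_summableD.
by apply/funext => m; rewrite mulN1r.
Qed.

(** Differentiation in a space direction maps the family of these series to
    itself, exchanging the cosine and sine coefficients. *)
Lemma hseries_space_derivative j u v : rapid u -> rapid v ->
  is_derive_within (@closed_halfspace R n) (delta_mx ord0 j, 0)
    (fun p => hseries u v p.1 p.2)
    (fun p => hseries (fun m => w * (m ord0 j)%:~R * v m)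
                      (fun m => - (w * (m ord0 j)%:~R) * u m) p.1 p.2).
Proof.
move=> ru rv; set u' := fun m => _ * v m; set v' := fun m => - _ * u m.
have ru' : rapid u' by apply: (rapid_mul rv) => m; exact: coord_le.
have rv' : rapid v' by apply: (rapid_mul ru) => m; rewrite normrN; exact: coord_le.
apply: (@hseries_derivative _ u v u' v' _ ru rv (harmonic_bound_summable ru' rv')).
- by move=> m p p0; exact: harmonic_le.
- move=> m p s p0 _ /=; rewrite /harmonic phase_delta [s *: 0]scaler0 addr0.
  set B := w * _; set A := phase w m p.1.
  rewrite -mulrBl mulrA normrM (ger0_norm (expR_ge0 _)) -[leRHS]mulr1.
  apply: ler_pM; rewrite ?expR_ge0 ?expR_rate_le1//.
  rewrite (_ : s^-1 * _ = u m * (s^-1 * (cos (A + s * B) - cos A)) +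
                       v m * (s^-1 * (sin (A + s * B) - sin A))); last by ring.
  have hc := quotient_le (cos_lipschitz A (A + s * B)).
  have hs := quotient_le (sin_lipschitz A (A + s * B)).
  apply: le_trans (ler_normD _ _) _; rewrite addrC /u' /v' -/B mulNr normrN.
  by apply: lerD; rewrite normrM mulrC [leRHS]normrM ler_wpM2r.
- move=> m p p0 /=; rewrite /harmonic.
  under eq_fun do rewrite phase_delta [_ *: 0]scaler0 addr0.
  set B := w * _; set A := phase w m p.1.
  rewrite (_ : (fun s : R => _) = fun s : R => (u m * (s^-1 * (cos (A + s * B) - cos A)) +
    v m * (s^-1 * (sin (A + s * B) - sin A))) * expR (- (rate m * p.2))); last first.
    by apply/funext => s; ring.
  apply: cvgMl.
  rewrite (_ : u' m * _ + _ = u m * (B * - sin A) + v m * (B * cos A)); last first.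
    by rewrite /u' /v' -/B; ring.
  by apply: cvgD; apply: cvgMr; exact: cvg_line.
Qed.

(** So does differentiation in time, one-sided at the boundary t = 0: the
    exponential is 1-Lipschitz on the non-positive numbers. *)
Lemma hseries_time_derivative u v : rapid u -> rapid v ->
  is_derive_within (@closed_halfspace R n) (0, 1)
    (fun p => hseries u v p.1 p.2)
    (fun p => hseries (fun m => - rate m * u m) (fun m => - rate m * v m) p.1 p.2).
Proof.
move=> ru rv; set u' := fun m => _ * u m; set v' := fun m => _ * v m.
have ru' : rapid u' by apply: (rapid_mul ru) => m; rewrite normrN; exact: rate_le.
have rv' : rapid v' by apply: (rapid_mul rv) => m; rewrite normrN; exact: rate_le.
apply: (@hseries_derivative _ u v u' v' _ ru rv (harmonic_bound_summable ru' rv')).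
- by move=> m p p0; exact: harmonic_le.
- move=> m p s p0 /=; rewrite [s *: 0]scaler0 addr0 [s *: 1]mulr1 => ps.
  rewrite /harmonic -mulrBr mulrCA normrM.
  apply: (@le_trans _ _ ((`|u m| + `|v m|) * `|- rate m|)).
    apply: ler_pM; rewrite ?cos_sin_le//.
    rewrite (_ : - (rate m * (p.2 + s)) = - (rate m * p.2) + s * - rate m); last by ring.
    apply: quotient_le; apply: expR_lipschitz; first by rewrite oppr_le0 mulr_ge0 ?rate_ge0.
    rewrite (_ : _ + _ = - (rate m * (p.2 + s))); last by ring.
    by rewrite oppr_le0 mulr_ge0 ?rate_ge0.
  by rewrite /u' /v' !normrM mulrC mulrDr.
- move=> m p p0 /=; rewrite /harmonic.
  set C := u m * _ + _.
  rewrite (_ : (fun s : R => _) = fun s : R => C * (s^-1 *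
    (expR (- (rate m * p.2) + s * - rate m) - expR (- (rate m * p.2))))); last first.
    apply/funext => s; rewrite [s *: 0]scaler0 addr0 [s *: 1]mulr1 -/C.
    rewrite (_ : - (rate m * (p.2 + s)) = - (rate m * p.2) + s * - rate m); ring.
  rewrite (_ : (_ + _) * _ = C * (- rate m * expR (- (rate m * p.2)))); last first.
    by rewrite /u' /v' /C; ring.
  by apply: cvgMr; exact: cvg_line.
Qed.

(** Since the family is closed under both kinds of derivatives, all orders of
    regularity follow by induction. *)
Lemma hseries_Cr k u v : rapid u -> rapid v ->
  Cr_within k (@spacetime_dir R n) (@closed_halfspace R n) (fun p => hseries u v p.1 p.2).
Proof.
elim: k u v => [|k IH] u v ru rv; split; try exact: hseries_continuous; first by [].
move=> dir [[j ->]|->].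
  exists (fun p => hseries (fun m => w * (m ord0 j)%:~R * v m)
                      (fun m => - (w * (m ord0 j)%:~R) * u m) p.1 p.2).
    exact: hseries_space_derivative.
  apply: IH; first by apply: (rapid_mul rv) => m; exact: coord_le.
  by apply: (rapid_mul ru) => m; rewrite normrN; exact: coord_le.
exists (fun p => hseries (fun m => - rate m * u m) (fun m => - rate m * v m) p.1 p.2).
  exact: hseries_time_derivative.
by apply: IH; [apply: (rapid_mul ru)|apply: (rapid_mul rv)] => m; rewrite normrN; exact: rate_le.
Qed.

End HarmonicSeries.

(** * Fourier inversion *)

Lemma rsum_delta (R : realType) (J : choiceType) (F : J -> R) j0 :
  abs_summable (fun j => F j * (j == j0)%:R) /\
  rsum (fun j => F j * (j == j0)%:R) = F j0.
Proof.
have S (f : J -> R) (K : {fset J}) : (forall j, j != j0 -> f j = 0) ->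
    \sum_(j <- K) f j = if j0 \in K then f j0 else 0.
  move=> f0; case: ifPn => jK.
    rewrite (bigD1_seq j0)//= ?fset_uniq// big1 ?addr0// => j; exact: f0.
  rewrite big_seq big1// => j jK'; apply: f0; apply: contraNneq jK.
  by move=> <-.
split.
  exists `|F j0| => K; rewrite S => [|j /negbTE ->]; last by rewrite mulr0 normr0.
  by rewrite eqxx mulr1; case: ifP.
apply: rsum_unique; apply: cvg_near_cst; exists [fset j0]%fset => // K /= jK.
rewrite partial_sumE S => [|j /negbTE ->]; last by rewrite mulr0.
by rewrite eqxx mulr1 (fsubsetP jK) ?inE.
Qed.

(** The uniform tail bound replaces a dominated convergence theorem for nets. *)
Lemma rintegral_rsum (R : realType) n (a : R) (J : choiceType)
    (q : J -> 'rV[R]_n -> R) (b : J -> R) :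
  0 <= a -> abs_summable b -> (forall j, continuous (q j)) ->
  (forall j x, box a x -> `|q j x| <= b j) ->
  continuous (fun x => rsum (fun j => q j x)) ->
  rintegral (box a) (fun x => rsum (fun j => q j x)) =
  rsum (fun j => rintegral (box a) (q j)).
Proof.
move=> a0 sb cq qb cs; apply/esym; apply: rsum_unique; apply/cvgrPdist_le => e e0.
have L0 : 0 <= (2 * a) ^+ n by rewrite exprn_ge0 ?mulr_ge0.
have e1 : 0 < e / ((2 * a) ^+ n + 1) by rewrite divr_gt0 ?ltr_wpDl.
have [K HK] := rsum_tail sb e1.
exists K => // H /= KH; rewrite partial_sumE -rintegral_sum//.
have cS : continuous (fun x => \sum_(j <- H) q j x) by exact: continuous_sumr.
rewrite -[X in _ - X]mul1r -mulNr -rintegralZ// -rintegralD//; last first.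
  by apply: continuous_mulr => //; exact: continuous_cstr.
apply: (@le_trans _ _ (e / ((2 * a) ^+ n + 1) * (2 * a) ^+ n)).
  apply: norm_rintegral_le => //.
    by apply: continuous_addr => //; apply: continuous_mulr => //; exact: continuous_cstr.
  move=> x bx; rewrite mulN1r; apply: (HK H KH (fun j => q j x)) => j; exact: qb.
rewrite mulrAC ler_pdivrMr ?ltr_wpDl// ler_pM2l//; lra.
Qed.

Section FourierInversion.
Variables (R : realType) (n : nat) (a w : R).
Hypotheses (a0 : 0 < a) (wa : `|w| * (2 * a) = 2 * pi).
Implicit Types (r s : 'rV[R]_n -> R) (m : 'rV[int]_n) (x : 'rV[R]_n).

Local Notation I := (rintegral (box a : set 'rV[R]_n)).
Local Notation E := (@space_dir R n).

Let a0' : 0 <= a := ltW a0.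

(** With c m the m-th complex Fourier coefficient of r + i s, [cos_coef r s] is the
    real part of c and [sin_coef r s] the opposite of its imaginary part: the real
    part of c m e^(i phase) is cos_coef * cos + sin_coef * sin. *)
Definition cos_coef r s m : R :=
  ((2 * a) ^+ n)^-1 * (I (fun x => r x * cos (phase w m x)) +
                       I (fun x => s x * sin (phase w m x))).

Definition sin_coef r s m : R :=
  ((2 * a) ^+ n)^-1 * (I (fun x => r x * sin (phase w m x)) -
                       I (fun x => s x * cos (phase w m x))).

Definition smooth_periodic r :=
  (forall k, Cr_within k E setT r) /\ rperiodic (2 * a) r.

Lemma smooth_periodic_continuous r : smooth_periodic r -> continuous r.
Proof. by case=> sr _; exact: Cr_within_continuous (sr 0%N). Qed.

Lemma rapid_integral r th : smooth_periodic r ->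
  rapid (fun m => I (fun x => r x * wave w m th x)).
Proof.
case=> sr pr N; have [C HC] := fourier_decay a0 wa N sr pr.
by exists C => m; exact: HC.
Qed.

Lemma cos_coefE r s m : cos_coef r s m = ((2 * a) ^+ n)^-1 *
  (I (fun x => r x * wave w m 0 x) + I (fun x => s x * wave w m (- (pi / 2)) x)).
Proof.
rewrite /cos_coef; congr (_ * (I _ + I _)); apply/funext => x.
  by rewrite cos_wave.
by rewrite sin_wave.
Qed.

Lemma sin_coefE r s m : sin_coef r s m = ((2 * a) ^+ n)^-1 *
  (I (fun x => r x * wave w m (- (pi / 2)) x) - I (fun x => s x * wave w m 0 x)).
Proof.
rewrite /sin_coef; congr (_ * (I _ - I _)); apply/funext => x.
  by rewrite sin_wave.
by rewrite cos_wave.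
Qed.

Lemma rapid_cos_coef r s : smooth_periodic r -> smooth_periodic s ->
  rapid (cos_coef r s).
Proof.
move=> sr ss; rewrite (funext (cos_coefE r s)).
by apply: rapidZ; apply: rapidD; exact: rapid_integral.
Qed.

Lemma rapid_sin_coef r s : smooth_periodic r -> smooth_periodic s ->
  rapid (sin_coef r s).
Proof.
move=> sr ss; rewrite (funext (sin_coefE r s)).
by apply: rapidZ; apply: rapidD; [|apply: rapidN]; exact: rapid_integral.
Qed.

Lemma continuous_harmonic_space (u v : 'rV[int]_n -> R) m t :
  continuous (fun x => harmonic w u v m x t).
Proof.
apply: continuous_mulr; last exact: continuous_cstr.
apply: continuous_addr; apply: continuous_mulr; try exact: continuous_cstr.
  by under eq_fun do rewrite cos_wave; exact: continuous_wave.
by under eq_fun do rewrite sin_wave; exact: continuous_wave.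
Qed.

Lemma hseries0_continuous (u v : 'rV[int]_n -> R) : rapid u -> rapid v ->
  continuous (fun x => hseries w u v x 0).
Proof.
move=> ru rv x; apply: (@cvg_rsum R _ _ (nbhs x) _ (fun y m => harmonic w u v m y 0) _ _
  (harmonic_bound_summable ru rv)).
- by move=> m; exact: harmonic_le.
- by apply: nearW => y m; exact: harmonic_le.
- by move=> m; exact: continuous_harmonic_space.
Qed.

Lemma rintegral_waveE m th : I (wave w m th) = cos th * (2 * a) ^+ n * (m == 0)%:R.
Proof.
have [->|m0] := eqVneq m 0; last by rewrite mulr0; exact: (rintegral_wave a0 wa).
rewrite mulr1 -rintegral_cst//; congr (I _); apply/funext => x.
by rewrite /wave phase0 add0r.
Qed.

(** Orthogonality of real waves: frequencies m and m' interact only if m = m' or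
    m = - m'. *)
Lemma rintegral_waveM m m' th th' : I (fun x => wave w m th x * wave w m' th' x) =
  2^-1 * (2 * a) ^+ n * (cos (th + th') * (m == - m')%:R + cos (th - th') * (m == m')%:R).
Proof.
have cw k t : continuous (wave w k t : 'rV[R]_n -> R) by exact: continuous_wave.
rewrite (_ : (fun x => _) = fun x => 2^-1 * (wave w (m + m') (th + th') x +
   wave w (m - m') (th - th') x)); last by apply/funext => x; rewrite waveM.
rewrite rintegralZ//; last exact: continuous_addr.
rewrite rintegralD// !rintegral_waveE addr_eq0 subr_eq0; ring.
Qed.

(** The difference of the two sides is continuous and orthogonal to every wave,
    hence zero. Against the wave of frequency m0 only the terms m = m0 and m = - m0 of
    the series survive; the contribution of s to the cosine coefficient is odd in m
    and to the sine coefficient even, so it cancels between m0 and - m0. *)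
Lemma fourier_inversion r s x : smooth_periodic r -> smooth_periodic s ->
  box a x -> hseries w (cos_coef r s) (sin_coef r s) x 0 = r x.
Proof.
move=> sr ss bx; set u := cos_coef r s; set v := sin_coef r s.
have ru : rapid u by exact: rapid_cos_coef.
have rv : rapid v by exact: rapid_sin_coef.
have cr := smooth_periodic_continuous sr.
have ch := hseries0_continuous ru rv.
apply/eqP; rewrite eq_sym -subr_eq0; apply/eqP.
apply: (@wave_orthogonal_eq0_box _ _ a w a0 wa (fun y => r y - hseries w u v y 0)) => //.
  by apply: continuous_addr => //; exact: continuous_oppr.
move=> m0 th.
have cw k t : continuous (wave w k t : 'rV[R]_n -> R) by exact: continuous_wave.
rewrite (_ : (fun y => _) = fun y => r y * wave w m0 th y +
   -1 * rsum (fun m => harmonic w u v m y 0 * wave w m0 th y)); last first.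
  apply/funext => y; rewrite mulrBl; congr (_ + _); rewrite mulN1r; congr (- _).
  by rewrite /hseries mulrC -rsumZ; [congr rsum; apply/funext => m; rewrite mulrC|exact: harmonic_summable].
have cS : continuous (fun y => rsum (fun m => harmonic w u v m y 0 * wave w m0 th y)).
  rewrite (_ : (fun y => _) = fun y => hseries w u v y 0 * wave w m0 th y).
    exact: continuous_mulr.
  apply/funext => y.
  by rewrite /hseries mulrC -rsumZ; [congr rsum; apply/funext => m; rewrite mulrC|exact: harmonic_summable].
rewrite rintegralD//; [|exact: continuous_mulr|]; last first.
  by apply: continuous_mulr => //; exact: continuous_cstr.
rewrite rintegralZ//.
have hE m y : harmonic w u v m y 0 = u m * wave w m 0 y + v m * wave w m (- (pi / 2)) y.
  by rewrite /harmonic mulr0 oppr0 expR0 mulr1 cos_wave sin_wave.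
rewrite (rintegral_rsum a0' (harmonic_bound_summable ru rv)) //; last first.
- move=> m y _; rewrite normrM -[leRHS]mulr1; apply: ler_pM => //.
    exact: harmonic_le.
  exact: norm_wave_le.
- move=> m; apply: continuous_mulr => //.
  under eq_fun do rewrite hE.
  by apply: continuous_addr; apply: continuous_mulr => //; exact: continuous_cstr.
pose F1 m := 2^-1 * (2 * a) ^+ n * (u m * cos th + v m * sin th).
pose F2 m := 2^-1 * (2 * a) ^+ n * (u m * cos th - v m * sin th).
rewrite (_ : (fun m => _) = fun m => F1 m * (m == - m0)%:R + F2 m * (m == m0)%:R); last first.
  apply/funext => m.
  rewrite (_ : (fun y => _) = fun y => u m * (wave w m 0 y * wave w m0 th y) +
     v m * (wave w m (- (pi / 2)) y * wave w m0 th y)); last first.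
    by apply/funext => y; rewrite hE; ring.
  have cww t : continuous (fun y : 'rV[R]_n => wave w m t y * wave w m0 th y) by exact: continuous_mulr.
  rewrite rintegralD//; try by apply: continuous_mulr => //; exact: continuous_cstr.
  rewrite !rintegralZ// !rintegral_waveM add0r sub0r cosN.
  rewrite [- (pi / 2) + th]addrC cosBpihalf -opprD cosN [pi / 2 + th]addrC cosDpihalf.
  rewrite /F1 /F2; ring.
have [s1 e1] := rsum_delta F1 (- m0); have [s2 e2] := rsum_delta F2 m0.
rewrite rsumD// e1 e2 /F1 /F2 /u /v !cos_coefE !sin_coefE.
have wE (f : 'rV[R]_n -> R) : continuous f ->
    I (fun y => f y * wave w m0 th y) = cos th * I (fun y => f y * wave w m0 0 y) -
      sin th * I (fun y => f y * wave w m0 (- (pi / 2)) y).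
  move=> cf.
  have cfw t : continuous (fun y : 'rV[R]_n => f y * wave w m0 t y) by exact: continuous_mulr.
  rewrite (_ : (fun y => _) = fun y => cos th * (f y * wave w m0 0 y) +
      - sin th * (f y * wave w m0 (- (pi / 2)) y)).
    rewrite rintegralD//; try by apply: continuous_mulr => //; exact: continuous_cstr.
    by rewrite !rintegralZ// mulNr.
  by apply/funext => y; rewrite -cos_wave -sin_wave /wave cosD; ring.
have wN (f : 'rV[R]_n -> R) : I (fun y => f y * wave w (- m0) 0 y) = I (fun y => f y * wave w m0 0 y).
  by congr (I _); apply/funext => y; rewrite /wave phaseN !addr0 cosN.
have wN' (f : 'rV[R]_n -> R) : continuous f -> I (fun y => f y * wave w (- m0) (- (pi / 2)) y) =
    - I (fun y => f y * wave w m0 (- (pi / 2)) y).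
  move=> cf; rewrite -[RHS]mulN1r -[RHS]rintegralZ//; last exact: continuous_mulr.
  by congr (I _); apply/funext => y; rewrite -!sin_wave phaseN sinN; ring.
have cs := smooth_periodic_continuous ss.
rewrite (wE r cr) !wN !wN'//.
have L0 : (2 * a) ^+ n != 0 by rewrite expf_neq0// mulf_neq0// gt_eqF.
by move: ((2 * a) ^+ n) L0 => L L0; field.
Qed.

End FourierInversion.

(** * The Laplace equation *)

Section HarmonicExtension.
Variables (R : realType) (n : nat) (w : R).
Implicit Types (u v : 'rV[int]_n -> R) (m : 'rV[int]_n) (x : 'rV[R]_n) (t : R).

(** Here the derivative is the two-sided one: a line in a space direction stays in
    the half-space. *)
Lemma hseries_space_derive j u v x t : rapid u -> rapid v -> 0 <= t ->
  'D_(delta_mx ord0 j) (fun y => hseries w u v y t) x =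
  hseries w (fun m => w * (m ord0 j)%:~R * v m)
            (fun m => - (w * (m ord0 j)%:~R) * u m) x t.
Proof.
move=> ru rv t0.
suff [_ ->] : is_derive x (delta_mx ord0 j) (fun y => hseries w u v y t)
  (hseries w (fun m => w * (m ord0 j)%:~R * v m)
             (fun m => - (w * (m ord0 j)%:~R) * u m) x t) by [].
apply/is_derive_lim; have := @hseries_space_derivative R n w j u v ru rv (x, t) t0 => /=.
rewrite (_ : within _ _ = 0^').
  by under eq_fun do rewrite [_ *: 0]scaler0 addr0.
apply/seteqP; split => A; rewrite /within /=; last by apply: filterS => s + _.
by apply: filterS => s; apply; rewrite /closed_halfspace/= [_ *: 0]scaler0 addr0.
Qed.

(** For t > 0 all small increments stay in the half-space, so the derivative
    within it is the two-sided one. *)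
Lemma hseries_time_derive u v x t : rapid u -> rapid v -> 0 < t ->
  'D_(1 : R^o) (hseries w u v x : R^o -> R) t =
  hseries w (fun m => - rate w m * u m) (fun m => - rate w m * v m) x t.
Proof.
move=> ru rv t0.
suff [_ ->] : is_derive (t : R^o) (1 : R^o) (hseries w u v x)
  (hseries w (fun m => - rate w m * u m) (fun m => - rate w m * v m) x t) by [].
apply/is_derive_lim; have := @hseries_time_derivative R n w u v ru rv (x, t) (ltW t0) => /=.
rewrite (_ : within _ _ = 0^').
  by under eq_fun do rewrite [_ *: 0]scaler0 addr0.
apply/seteqP; split => A; rewrite /within /=; last by apply: filterS => s + _.
move=> H; near=> s; apply: (near H s) => //.
rewrite /closed_halfspace/= [_ *: 1]mulr1 -lerBlDl sub0r.
have : - t < s by near: s; apply: nbhs_dnbhs; apply: lt_nbhsr; lra.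
lra.
Unshelve. all: by end_near. Qed.

Lemma rapid_rate u : rapid u -> rapid (fun m => - rate w m * u m).
Proof. by move=> ru; apply: (rapid_mul ru) => m; rewrite normrN; exact: rate_le. Qed.

Lemma rapid_coord j u : rapid u -> rapid (fun m => w * (m ord0 j)%:~R * u m).
Proof. by move=> ru; apply: (rapid_mul ru) => m; exact: coord_le. Qed.

Lemma rapid_coordN j u : rapid u -> rapid (fun m => - (w * (m ord0 j)%:~R) * u m).
Proof. by move=> ru; apply: (rapid_mul ru) => m; rewrite normrN; exact: coord_le. Qed.

Lemma hseries_space_derive2 j u v x t : rapid u -> rapid v -> 0 <= t ->
  'D_(delta_mx ord0 j) (fun y => 'D_(delta_mx ord0 j) (fun z => hseries w u v z t) y) x =
  rsum (fun m => - (w ^+ 2 * (m ord0 j)%:~R ^+ 2) * harmonic w u v m x t).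
Proof.
move=> ru rv t0.
under eq_fun do rewrite hseries_space_derive//.
rewrite hseries_space_derive//; [|exact: rapid_coord|exact: rapid_coordN].
by congr rsum; apply/funext => m; rewrite /harmonic; ring.
Qed.

Lemma hseries_time_derive2 u v x t : rapid u -> rapid v -> 0 < t ->
  'D_(1 : R^o) (fun s : R^o => 'D_(1 : R^o) (hseries w u v x : R^o -> R) s) t =
  rsum (fun m => w ^+ 2 * freq R m * harmonic w u v m x t).
Proof.
move=> ru rv t0.
rewrite (@near_eq_derive _ _ _ _ (hseries w (fun m => - rate w m * u m)
  (fun m => - rate w m * v m) x : R^o -> R)).
- rewrite hseries_time_derive//; [|exact: rapid_rate|exact: rapid_rate].
  by congr rsum; apply/funext => m; rewrite -rate_sqr /harmonic; ring.
- by near=> s; rewrite hseries_time_derive//; near: s; exact: lt_nbhsr.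
Unshelve. all: by end_near. Qed.

(** The second time derivative multiplies the m-th term by rate^2 = w^2 |m|^2, the
    second space derivatives by - w^2 m_j^2, and these multipliers sum to zero. *)
Lemma hseries_harmonic u v x t : rapid u -> rapid v -> 0 < t ->
  'D_(1 : R^o) (fun s : R^o => 'D_(1 : R^o) (hseries w u v x : R^o -> R) s) t +
  \sum_(j < n) 'D_(delta_mx ord0 j)
    (fun y => 'D_(delta_mx ord0 j) (fun z => hseries w u v z t) y) x = 0.
Proof.
move=> ru rv t0.
have Hsum (s : seq 'I_n) :
  let p m := \sum_(j <- s) - (w ^+ 2 * (m ord0 j)%:~R ^+ 2) in
  abs_summable (fun m => p m * harmonic w u v m x t) /\
  \sum_(j <- s) rsum (fun m => - (w ^+ 2 * (m ord0 j)%:~R ^+ 2) * harmonic w u v m x t) =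
  rsum (fun m => p m * harmonic w u v m x t).
  elim: s => [|j s [s1 IH]] /=.
    under eq_fun do rewrite big_nil mul0r.
    have s0 : abs_summable (fun _ : 'rV[int]_n => 0 : R).
      by exists 0 => J; rewrite big1// => m _; rewrite normr0.
    split=> //; rewrite big_nil -[LHS](mul0r (rsum (fun _ : 'rV[int]_n => 0 : R))).
    by rewrite -rsumZ//; congr rsum; apply/funext => m; rewrite mul0r.
  have s2 : abs_summable (fun m => - (w ^+ 2 * (m ord0 j)%:~R ^+ 2) * harmonic w u v m x t).
    have := @harmonic_summable R n w _ _ x t (rapid_coord j (rapid_coordN j ru))
      (rapid_coordN j (rapid_coord j rv)) (ltW t0).
    by congr abs_summable; apply/funext => m; rewrite /harmonic; ring.
  under eq_fun do rewrite big_cons mulrDl; split; first exact: abs_summableD.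
  by rewrite big_cons IH -rsumD.
rewrite hseries_time_derive2//.
under eq_bigr do rewrite hseries_space_derive2// 1?ltW//.
have [s1 ->] := Hsum (index_enum 'I_n).
rewrite -rsumD//.
  rewrite (_ : (fun m => _) = fun m => 0 * harmonic w u v m x t).
    by rewrite rsumZ ?mul0r//; apply: harmonic_summable => //; exact: ltW.
  apply/funext => m; rewrite sumrN -mulr_sumr -freqE; ring.
have := @harmonic_summable R n w _ _ x t (rapid_rate (rapid_rate ru))
      (rapid_rate (rapid_rate rv)) (ltW t0).
by congr abs_summable; apply/funext => m; rewrite -rate_sqr /harmonic; ring.
Qed.

Lemma hseries_periodic (a : R) u v t : `|w| * (2 * a) = 2 * pi ->
  rperiodic (2 * a) (fun x => hseries w u v x t).
Proof.
move=> wa j x; congr rsum; apply/funext => m.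
by rewrite /harmonic !cos_wave !sin_wave !(wave_periodic wa).
Qed.

End HarmonicExtension.

(** * The Poisson kernel *)

Section PoissonKernel.
Variables (R : realType) (n : nat) (a w : R).
Hypotheses (a0 : 0 < a) (wa : `|w| * (2 * a) = 2 * pi).
Implicit Types (r s : 'rV[R]_n -> R) (m : 'rV[int]_n) (x y : 'rV[R]_n) (t : R).

Local Notation I := (rintegral (box a : set 'rV[R]_n)).

(** For t > 0 the damping factors alone decay rapidly, so the Poisson kernel
    converges absolutely without any help from the datum. *)
Lemma rapid_damping t : 0 < t -> rapid (fun m : 'rV[int]_n => expR (- (rate w m * t))).
Proof.
move=> t0 N.
have w0 : 0 < `|w| by rewrite normr_gt0 (frequency_neq0 wa).
(* Write rate * t = c z k with z = |m| and k = 2 N + 1, any number above 2 N. Since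
   e^(c z) >= 1 + c z, the exponential of c z k dominates (1 + c z)^(2 N), hence
   d^N (1 + z^2)^N for d = min (1, c^2). *)
pose k : R := (2 * N)%:R + 1.
have k0 : 0 < k by rewrite ltr_wpDl.
pose c := `|w| * t / k.
have c0 : 0 < c by rewrite divr_gt0 ?mulr_gt0.
pose d := Num.min 1 (c ^+ 2).
have d0 : 0 < d by rewrite lt_min ltr01 exprn_gt0.
exists (d ^- N) => m.
have q0 := freq_ge0 R m.
set z := enorm (intvec R m).
have z0 : 0 <= z by exact: sqrtr_ge0.
have z2 : z ^+ 2 = freq R m by rewrite sqr_sqrtr.
have zE : rate w m * t = c * z * k by rewrite /rate /c -/z; field; lra.
rewrite (ger0_norm (expR_ge0 _)) expRN ler_pdivrMr ?expR_gt0// mulrC.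
rewrite ler_pdivlMr ?exprn_gt0//.
rewrite -exprMn_comm; last exact: mulrC.
have cz0 : 0 <= c * z by rewrite mulr_ge0// ltW.
have h1 : (1 + freq R m) * d <= (1 + c * z) ^+ 2.
  have d1 : d <= 1 by rewrite ge_min lexx.
  have d2 : d <= c ^+ 2 by rewrite ge_min lexx orbT.
  rewrite -z2 mulrDl mul1r sqrrD expr1n mul1r exprMn.
  have : z ^+ 2 * d <= z ^+ 2 * c ^+ 2 by rewrite ler_wpM2l ?sqr_ge0.
  have : 0 <= c * z *+ 2 by rewrite mulrn_wge0.
  lra.
apply: (@le_trans _ _ ((1 + c * z) ^+ 2 ^+ N)).
  by apply: lerXn2r; rewrite ?nnegrE ?sqr_ge0// mulr_ge0 ?addr_ge0// ltW.
rewrite -exprM zE -/k.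
apply: (@le_trans _ _ (expR (c * z) ^+ (2 * N))).
  by apply: lerXn2r; rewrite ?nnegrE ?expR_ge0 ?addr_ge0 ?expR_ge1Dx.
rewrite -expRM_natr ler_expR ler_wpM2l// /k; lra.
Qed.

(** The sum defining the Poisson kernel is exchanged with the integral, and the
    addition formulas separate x from y. The two real series stand for the real and
    the imaginary part of the kernel, so the left-hand side is the real part of the
    integral of (r + i s) times the kernel. *)
Lemma poisson_convolution r s x t : smooth_periodic a r ->
  smooth_periodic a s -> 0 < t ->
  let e m := expR (- (rate w m * t)) in
  I (fun y => r y * rsum (fun m => e m * cos (phase w m (x - y))) -
              s y * rsum (fun m => e m * sin (phase w m (x - y)))) =
  (2 * a) ^+ n * hseries w (cos_coef a w r s) (sin_coef a w r s) x t.
Proof.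
move=> sr ss t0 e.
have [cr cs] := (smooth_periodic_continuous sr, smooth_periodic_continuous ss).
have a0' := ltW a0.
have re : rapid e by exact: rapid_damping.
have se := rapid_abs_summable re.
have e_ge0 m : 0 <= e m by exact: expR_ge0.
have sec y : abs_summable (fun m => e m * cos (phase w m (x - y))).
  by apply: abs_summable_le se => m; rewrite normrM ler_piMr// cos_max.
have ses y : abs_summable (fun m => e m * sin (phase w m (x - y))).
  by apply: abs_summable_le se => m; rewrite normrM ler_piMr// sin_max.
pose q m y := e m * (r y * cos (phase w m (x - y)) - s y * sin (phase w m (x - y))).
have qE y : r y * rsum (fun m => e m * cos (phase w m (x - y))) -
    s y * rsum (fun m => e m * sin (phase w m (x - y))) = rsum (fun m => q m y).
  rewrite -!rsumZ// -mulN1r -rsumZ; last exact: abs_summableZ.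
  rewrite -rsumD; [|exact: abs_summableZ|]; last by do 2 apply: abs_summableZ.
  by congr rsum; apply/funext => m; rewrite /q; ring.
rewrite (funext qE).
have cph m : continuous (fun y => phase w m (x - y)).
  under eq_fun do rewrite phaseB.
  by apply: continuous_addr; [exact: continuous_cstr|apply: continuous_oppr; exact: continuous_phase].
have ccos m : continuous (fun y => cos (phase w m (x - y))) by exact: continuous_cos_comp.
have csin m : continuous (fun y => sin (phase w m (x - y))).
  by move=> y; apply: (@continuous_comp _ _ _ (fun y => phase w m (x - y)) sin);
    [exact: cph|exact: continuous_sin].
have cq m : continuous (q m).
  apply: continuous_mulr; first exact: continuous_cstr.
  by apply: continuous_addr; [|apply: continuous_oppr]; exact: continuous_mulr.
have csum (f : 'rV[int]_n -> 'rV[R]_n -> R) : (forall m, continuous (f m)) ->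
    (forall m y, `|f m y| <= 1) -> continuous (fun y => rsum (fun m => e m * f m y)).
  move=> cf f1 y; apply: (@cvg_rsum R _ _ (nbhs y) _ (fun z m => e m * f m z) _ _ se).
  - by move=> m; rewrite normrM ger0_norm// ler_piMr.
  - by apply: nearW => z m; rewrite normrM ger0_norm// ler_piMr.
  - by move=> m; apply: (continuous_mulr (@continuous_cstr _ _ (e m)) (cf m)).
have [M M0 HM] := continuous_bounded_box a cr.
have [M' M0' HM'] := continuous_bounded_box a cs.
rewrite (@rintegral_rsum _ _ _ _ q (fun m => (M + M') * e m))//; last first.
- rewrite -(funext qE); apply: continuous_addr; [|apply: continuous_oppr];
    apply: continuous_mulr => //; apply: csum => // m y; [exact: cos_max|exact: sin_max].
- move=> m y ya; rewrite normrM ger0_norm// mulrC ler_wpM2r//.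
  apply: le_trans (ler_normB _ _) _; rewrite !normrM; apply: lerD.
    by rewrite -[leRHS]mulr1 ler_pM ?HM ?cos_max.
  by rewrite -[leRHS]mulr1 ler_pM ?HM' ?sin_max.
- exact: abs_summableZ.
have L0 : (2 * a) ^+ n != 0 by rewrite expf_neq0// mulf_neq0// gt_eqF.
rewrite /hseries -rsumZ; last first.
  by apply: harmonic_summable; [exact: rapid_cos_coef|exact: rapid_sin_coef|exact: ltW].
congr rsum; apply/funext => m; rewrite /harmonic /cos_coef /sin_coef -/(e m).
have cw : continuous (fun y : 'rV[R]_n => cos (phase w m y)).
  by under eq_fun do rewrite cos_wave; exact: continuous_wave.
have sw : continuous (fun y : 'rV[R]_n => sin (phase w m y)).
  by under eq_fun do rewrite sin_wave; exact: continuous_wave.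
have crc : continuous (fun y => r y * cos (phase w m y)) by exact: continuous_mulr.
have crs : continuous (fun y => r y * sin (phase w m y)) by exact: continuous_mulr.
have csc : continuous (fun y => s y * cos (phase w m y)) by exact: continuous_mulr.
have css : continuous (fun y => s y * sin (phase w m y)) by exact: continuous_mulr.
set C := cos (phase w m x); set S := sin (phase w m x).
have cZ k (f : 'rV[R]_n -> R) : continuous f -> continuous (fun y => k * f y).
  by move=> cf; apply: continuous_mulr => //; exact: continuous_cstr.
rewrite (_ : q m = fun y => e m * (C * (r y * cos (phase w m y)) + S * (r y * sin (phase w m y))
   + (C * (s y * sin (phase w m y)) + (- S) * (s y * cos (phase w m y))))); last first.
  by apply/funext => y; rewrite /q phaseB cosB sinB -/C -/S; ring.
have c1 : continuous (fun y => C * (r y * cos (phase w m y)) + S * (r y * sin (phase w m y))).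
  by apply: continuous_addr; exact: cZ.
have c2 : continuous (fun y => C * (s y * sin (phase w m y)) + - S * (s y * cos (phase w m y))).
  by apply: continuous_addr; exact: cZ.
rewrite rintegralZ//; last exact: continuous_addr.
rewrite !rintegralD//; try exact: cZ.
rewrite !rintegralZ//.
by move: ((2 * a) ^+ n) L0 => L L0; field.
Qed.

End PoissonKernel.

(** * Complex numbers, chirps and the theorem *)

Section ComplexNumbers.
Variable R : realType.
Implicit Types (z : R[i]) (x y : R).

Lemma complexM (a b c d : R) :
  (a +i* b) * (c +i* d) = (a * c - b * d) +i* (a * d + b * c).
Proof. by []. Qed.

Lemma complex_eta z : z = Re z +i* Im z.
Proof. by case: z. Qed.

Lemma sum_complex (J : Type) (s : seq J) (a b : J -> R) :
  \sum_(j <- s) (a j +i* b j) = (\sum_(j <- s) a j) +i* (\sum_(j <- s) b j).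
Proof.
by elim: s => [|j s IH]; rewrite ?big_nil// !big_cons IH.
Qed.

Lemma expiD x y : expi (x + y) = expi x * expi y.
Proof. by rewrite /expi complexM cosD sinD; congr (_ +i* _); ring. Qed.

Lemma expi0 : expi 0 = 1 :> R[i].
Proof. by rewrite /expi cos0 sin0. Qed.

Lemma expi_mulN x : expi x * expi (- x) = 1.
Proof. by rewrite -expiD subrr expi0. Qed.

(** The principal square roots of conjugate numbers are conjugate; the boundary
    case of the sign convention, c = 0, has zero imaginary part. *)
Lemma sqrtc_mul_conj (c : R) :
  sqrtc (1 -i* c) * sqrtc (1 +i* c) = (Num.sqrt (1 + c ^+ 2))%:C.
Proof.
rewrite /= sqrrN expr1n; set r := Num.sqrt (1 + c ^+ 2).
have r1 : 1 <= r by rewrite -[leLHS]sqrtr1 ler_wsqrtr// lerDl sqr_ge0.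
rewrite complexM oppr_eq0 sgrN.
have [c0|c0] := eqVneq c 0.
  have -> : r = 1 by rewrite /r c0 expr0n/= addr0 sqrtr1.
  rewrite subrr mul0r sqrtr0 !(mulr0, mul0r, subr0, addr0).
  by congr (_ +i* _); rewrite -expr2 sqr_sqrtr; lra.
set p := Num.sqrt ((r + 1) / 2); set q := Num.sqrt ((r - 1) / 2).
have p2 : p * p = (r + 1) / 2 by rewrite -expr2 sqr_sqrtr//; lra.
have q2 : q * q = (r - 1) / 2 by rewrite -expr2 sqr_sqrtr//; lra.
have s2 : Num.sg c * Num.sg c = 1 by rewrite -expr2 sqr_sg c0.
congr (_ +i* _); last by ring.
rewrite (_ : _ - _ = p * p + (Num.sg c * Num.sg c) * (q * q)); last by ring.
rewrite s2 p2 q2; lra.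
Qed.

Lemma has_csumZ (J : choiceType) (k : R[i]) (a b : J -> R) :
  abs_summable a -> abs_summable b ->
  has_csum (fun j => k * (a j +i* b j)) (k * (rsum a +i* rsum b)).
Proof.
case: k => k1 k2 sa sb.
have s1 := abs_summableD (abs_summableZ k1 sa) (abs_summableZ (- k2) sb).
have s2 := abs_summableD (abs_summableZ k1 sb) (abs_summableZ k2 sa).
split.
  rewrite (_ : Re _ = rsum (fun j => k1 * a j + - k2 * b j)).
    rewrite (_ : (fun j => Re _) = fun j => k1 * a j + - k2 * b j).
      exact: rsum_cvg.
    by apply/funext => j; rewrite mulNr.
  by rewrite rsumD ?rsumZ ?mulNr//; exact: abs_summableZ.
rewrite (_ : Im _ = rsum (fun j => k1 * b j + k2 * a j)); first exact: rsum_cvg.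
by rewrite rsumD ?rsumZ//; exact: abs_summableZ.
Qed.

End ComplexNumbers.

Section ComplexIntegral.
Variables (R : realType) (n : nat) (a : R).
Hypothesis a0 : 0 <= a.

Lemma eq_cintegral (h k : 'rV[R]_n -> R[i]) : (forall x, box a x -> h x = k x) ->
  cintegral (box a) h = cintegral (box a) k.
Proof.
move=> hk; congr (_ +i* _); apply: (@eq_rintegral _ _ _ (fun x => _ (h x)) (fun x => _ (k x)));
  by move=> x /hk ->.
Qed.

Lemma cintegralZ (k : R[i]) (h1 h2 : 'rV[R]_n -> R) :
  continuous h1 -> continuous h2 ->
  cintegral (box a) (fun x => k * (h1 x +i* h2 x)) =
  k * (rintegral (box a) h1 +i* rintegral (box a) h2).
Proof.
case: k => k1 k2 c1 c2.
have cZ c (h : 'rV[R]_n -> R) : continuous h -> continuous (fun x => c * h x).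
  by move=> ch; apply: continuous_mulr => //; exact: continuous_cstr.
rewrite (_ : (fun x => _) = fun x =>
    (k1 * h1 x + - k2 * h2 x) +i* (k1 * h2 x + k2 * h1 x)); last first.
  by apply/funext => x; rewrite complexM mulNr.
rewrite -[LHS]/(rintegral (box a) (fun x => k1 * h1 x + - k2 * h2 x) +i*
                rintegral (box a) (fun x => k1 * h2 x + k2 * h1 x)).
rewrite !rintegralD//; try exact: cZ.
by rewrite !rintegralZ// complexM mulNr.
Qed.

End ComplexIntegral.

(** With b the remainder of alpha modulo pi, cos (2 b) = cos (2 alpha), so sin b
    vanishes together with sin alpha; but sin is positive on ]0, pi[. *)
Lemma sin_neq0 (R : realType) (alpha : R) :
  (forall k : int, alpha <> k%:~R * pi) -> sin alpha != 0.
Proof.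
move=> ak; apply/eqP => s0.
have p0 := pi_gt0 R.
pose k := Num.floor (alpha / pi).
pose b := alpha - k%:~R * pi.
have b0 : 0 <= b.
  by rewrite subr_ge0 -ler_pdivlMr// floor_le.
have b1 : b < pi.
  have := floorD1_gt (alpha / pi); rewrite -/k intrD ltr_pdivrMr// mulrDl mul1r /b; lra.
have cb : cos (b *+ 2) = 1.
  have -> : b *+ 2 = alpha *+ 2 + (2 * pi) * (- k)%:~R.
    by rewrite /b intrN !mulr2n; ring.
  rewrite cos_periodic_int cos_mulr2n cos2sin2 s0; lra.
have sb : sin b = 0.
  apply/eqP; rewrite -sqrf_eq0; apply/eqP.
  by move: cb; rewrite cos_mulr2n cos2sin2 mulr2n; lra.
have [bp|b2] := ltP 0 b.
  by have : 0 < sin b; [apply: sin_gt0_pi; rewrite bp|rewrite sb ltxx].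
apply: (ak k); apply/eqP; rewrite -subr_eq0 -/b; apply/eqP; lra.
Qed.

Section Chirps.
Variables (R : realType) (n : nat) (alpha : R).
Hypothesis sin0 : sin alpha != 0.
Implicit Types (x y : 'rV[R]_n) (m : 'rV[int]_n).

Let w := 2 * pi * csc alpha.
Let a := period alpha / 2.

Lemma half_period_gt0 : 0 < a.
Proof. by rewrite divr_gt0// normr_gt0. Qed.

Lemma frequency_period : `|w| * (2 * a) = 2 * pi.
Proof.
rewrite /w /a /csc /period !normrM normfV (ger0_norm (ler0n R 2)) (ger0_norm (pi_ge0 R)).
by field; rewrite normr_eq0.
Qed.

Lemma chirp_mulN x : chirp alpha x * chirp (- alpha) x = 1.
Proof.
rewrite /chirp /cotan cosN sinN invrN.
by rewrite (_ : _ * (_ * - _) = - (pi * enorm x ^+ 2 * (cos alpha / sin alpha)));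
  [exact: expi_mulN|ring].
Qed.

(** This is 1 + cot^2 = csc^2: the normalising constants of [fracK] at alpha and
    - alpha combine to the inverse of the side of the torus. *)
Lemma fracA_mulN : fracA alpha * fracA (- alpha) = (`|csc alpha|)%:C.
Proof.
rewrite /fracA (_ : 1 -i* cotan (- alpha) = 1 +i* cotan alpha); last first.
  by rewrite /cotan cosN sinN invrN mulrN opprK.
rewrite sqrtc_mul_conj -sqrtr_sqr; congr (_%:C); congr Num.sqrt.
rewrite /cotan /csc expr_div_n exprVn.
by rewrite cos2sin2; field.
Qed.

Lemma echarE m x : echar alpha m x = expi (- phase w m x).
Proof. by rewrite /echar /phase /w; congr (expi _); ring. Qed.

Lemma echarNE m x : echar (- alpha) m x = expi (phase w m x).
Proof. by rewrite /echar /phase /w /csc sinN invrN; congr (expi _); ring. Qed.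

Lemma dampingE t m : damping alpha t m = expR (- (rate w m * t)).
Proof.
rewrite /damping /rate /w !normrM (ger0_norm (ler0n R 2)) (ger0_norm (pi_ge0 R)).
by congr expR; ring.
Qed.

Lemma csc_period : `|csc alpha| ^+ n * (2 * a) ^+ n = 1.
Proof.
rewrite -exprMn_comm; last exact: mulrC.
rewrite /csc /a /period normfV (_ : _ * _ = 1) ?expr1n//.
by field; rewrite normr_eq0.
Qed.

End Chirps.

Theorem proposition6p5 (R : realType) (n : nat) (alpha : R)
    (f : 'rV[R]_n -> R[i]) :
  (0 < n)%N ->
  (forall k : int, alpha <> k%:~R * pi) ->
  chirp_smooth alpha f ->
  exists F G : 'rV[R]_n -> R -> R[i],
    [/\ is_periodic_lift alpha F G,
        frac_dirichlet alpha f F G,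
        ccontinuous_within (@closed_halfspace R n) (fun p => G p.1 p.2),
        smooth_within (@spacetime_dir R n) (@closed_halfspace R n)
          (fun p => G p.1 p.2) &
        (forall x t, cube alpha x -> 0 < t ->
           F x t = fracconv alpha f (fracPoisson alpha t) x) /\
        (forall x t, cube alpha x -> 0 <= t ->
           has_csum (fun m : 'rV[int]_n =>
             fracF alpha f m * (damping alpha t m)%:C * fracK (- alpha) m x)
             (F x t))].
Proof.
move=> _ /sin_neq0 s0 [g [sg pg fg]].
set w : R := 2 * pi * csc alpha; set a : R := period alpha / 2.
have a0 : 0 < a := half_period_gt0 s0.
have a0' := ltW a0.
have wa : `|w| * (2 * a) = 2 * pi := frequency_period s0.
have a2 : 2 * a = period alpha by rewrite /a mulrC divfK.
pose gr y : R := Re (g y); pose gi y : R := Im (g y); pose gr' y : R := - gr y.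
have gE y : g y = gr y +i* gi y by exact: complex_eta.
have sr : smooth_periodic a gr.
  split=> [k|j y]; first exact: (sg k).1.
  by rewrite a2; congr (Re _); exact: pg.
have si : smooth_periodic a gi.
  split=> [k|j y]; first exact: (sg k).2.
  by rewrite a2; congr (Im _); exact: pg.
have sr' : smooth_periodic a gr'.
  split=> [k|j y]; last by rewrite /gr' sr.2.
  rewrite (_ : gr' = fun y => -1 * gr y); last by apply/funext => y; rewrite mulN1r.
  by apply: Cr_withinZ; exact: sr.1.
have [cr ci] := (smooth_periodic_continuous sr, smooth_periodic_continuous si).
pose u := cos_coef a w gr gi; pose v := sin_coef a w gr gi.
have ru : rapid u by exact: rapid_cos_coef.
have rv : rapid v by exact: rapid_sin_coef.
(* Im g is the real part of - i g, that is, of the pair (gi, - gr). *)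
have uE : sin_coef a w gi gr' = u.
  apply/funext => m; rewrite /sin_coef /u /cos_coef addrC; congr (_ * (_ + _)).
  rewrite -mulN1r -rintegralZ//; last first.
    apply: continuous_mulr; first exact: continuous_oppr.
    by under eq_fun do rewrite cos_wave; exact: continuous_wave.
  by apply: eq_rintegral => y _; rewrite /gr'; ring.
pose v' m := - v m.
have vE : cos_coef a w gi gr' = v'.
  apply/funext => m; rewrite /cos_coef /v' /v /sin_coef -mulrN opprB; congr (_ * (_ + _)).
  rewrite -[RHS]mulN1r -[RHS]rintegralZ//; last first.
    apply: continuous_mulr => //.
    by under eq_fun do rewrite sin_wave; exact: continuous_wave.
  by apply: eq_rintegral => y _; rewrite /gr'; ring.
have rv' : rapid v' by exact: rapidN.
(* (u - i v) e^(i phase) has real part u cos + v sin and imaginary part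
   - v cos + u sin. *)
pose G (x : 'rV[R]_n) t : R[i] := hseries w u v x t +i* hseries w v' u x t.
pose F x t : R[i] := chirp (- alpha) x * G x t.
have G0 x : cube alpha x -> G x 0 = g x.
  move=> bx; rewrite /G gE -vE -{2}uE; congr (_ +i* _);
    exact: (fourier_inversion a0 wa).
have cosw m : continuous (fun y : 'rV[R]_n => cos (phase w m y)).
  by under eq_fun do rewrite cos_wave; exact: continuous_wave.
have sinw m : continuous (fun y : 'rV[R]_n => sin (phase w m y)).
  by under eq_fun do rewrite sin_wave; exact: continuous_wave.
have FcE m : fracF alpha f m = fracA alpha ^+ n * chirp alpha (intvec R m) *
    ((2 * a) ^+ n)%:C * (u m +i* v' m).
  rewrite /fracF.
  rewrite (@eq_cintegral _ _ a _ (fun y => (fracA alpha ^+ n * chirp alpha (intvec R m)) *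
     ((gr y * cos (phase w m y) + gi y * sin (phase w m y)) +i*
      (gi y * cos (phase w m y) + gr' y * sin (phase w m y))))); last first.
    move=> y by_; rewrite fg// /fracK echarE -/w.
    rewrite (_ : _ * _ = (chirp alpha y * chirp (- alpha) y) *
      ((fracA alpha ^+ n * chirp alpha (intvec R m)) * (g y * expi (- phase w m y)))); last by ring.
    rewrite chirp_mulN mul1r; congr (_ * _).
    rewrite gE /expi complexM cosN sinN; congr (_ +i* _); rewrite /gr'; ring.
  rewrite cintegralZ//; try by apply: continuous_addr; apply: continuous_mulr => //; exact: continuous_oppr.
  rewrite -[RHS]mulrA; congr (_ * _).
  rewrite !rintegralD//; try by apply: continuous_mulr => //; exact: continuous_oppr.
  rewrite complexM /v' -/(v' m) -vE /u /cos_coef.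
  have L0 : (2 * a) ^+ n != 0 by rewrite expf_neq0// mulf_neq0// gt_eqF.
  rewrite !mul0r subr0 addr0 !(mulrA _ _^-1) mulfV// !mul1r.
  by [].
have termE m x t : fracF alpha f m * (damping alpha t m)%:C * fracK (- alpha) m x =
    chirp (- alpha) x * (harmonic w u v m x t +i* harmonic w v' u m x t).
  rewrite FcE /fracK echarNE -/w dampingE -/w.
  have rearrange (A A' k k' X E D L c : R[i]) : A ^+ n * k * L * c * D *
      (A' ^+ n * X * E * k') = (A * A') ^+ n * L * (k * k') * (X * (c * D * E)).
    by rewrite exprMn; ring.
  rewrite rearrange.
  rewrite chirp_mulN (fracA_mulN s0) -rmorphXn -rmorphM (csc_period n s0) rmorph1 !mul1r.
  congr (_ * _); rewrite /expi !complexM /harmonic /v'.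
  by congr (_ +i* _); ring.
exists F, G; split.
- move=> t t0; split=> [j x|x bx].
    by rewrite /G -a2; congr (_ +i* _); exact: (hseries_periodic _ _ _ wa).
  by rewrite /F mulrA chirp_mulN mul1r.
- split=> [x t t0|x bx]; last by rewrite /F G0// fg.
  rewrite /time_derive2 /space_derive2 /cderive sum_complex.
  rewrite -[LHS]/(('D_(1 : R^o) (fun s : R^o => 'D_(1 : R^o) (hseries w u v x : R^o -> R) s) t +
    \sum_(j < n) 'D_(delta_mx ord0 j)
      (fun y => 'D_(delta_mx ord0 j) (fun z => hseries w u v z t) y) x) +i*
    ('D_(1 : R^o) (fun s : R^o => 'D_(1 : R^o) (hseries w v' u x : R^o -> R) s) t +
    \sum_(j < n) 'D_(delta_mx ord0 j)
      (fun y => 'D_(delta_mx ord0 j) (fun z => hseries w v' u z t) y) x)).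
  exact: (f_equal2 (@Complex R) (hseries_harmonic w x ru rv t0) (hseries_harmonic w x rv' ru t0)).
- by split; [exact: (@hseries_continuous R n w u v ru rv)|exact: (@hseries_continuous R n w v' u rv' ru)].
- by move=> k; split; [exact: (hseries_Cr w k ru rv)|exact: (hseries_Cr w k rv' ru)].
split=> x t bx t0; last first.
  rewrite (funext (fun m => termE m x t)) /F /G.
  by apply: has_csumZ; exact: harmonic_summable.
rewrite /fracconv /F mulrAC -[LHS]mulrC; congr (_ * _).
pose e (m : 'rV[int]_n) := expR (- (rate w m * t)).
pose P1 (y : 'rV[R]_n) := rsum (fun m => e m * cos (phase w m (x - y))).
pose P2 (y : 'rV[R]_n) := rsum (fun m => e m * sin (phase w m (x - y))).
have PE y : fracPoisson alpha t (csc alpha *: (x - y)) = P1 y +i* P2 y.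
  have phaseE m : 2 * pi * dotmul (intvec R m) (csc alpha *: (x - y)) = phase w m (x - y).
    rewrite /phase /w -[RHS]mulrA; congr (_ * _); rewrite /dotmul mulr_sumr.
    by apply: eq_bigr => j _; rewrite !mxE; ring.
  rewrite /fracPoisson (_ : (fun m => _) = fun m =>
    (e m * cos (phase w m (x - y))) +i* (e m * sin (phase w m (x - y)))) //.
  apply/funext => m; rewrite dampingE -/w phaseE /expi complexM -/(e m).
  by rewrite !mul0r subr0 addr0.
rewrite (@eq_cintegral _ _ a _ (fun y => (gr y * P1 y - gi y * P2 y) +i*
   (gi y * P1 y - gr' y * P2 y))); last first.
  move=> y by_; rewrite fg// mulrA chirp_mulN mul1r PE gE complexM.
  by congr (_ +i* _); rewrite /gr'; ring.
rewrite -[cintegral _ _]/(rintegral (box a) (fun y => gr y * P1 y - gi y * P2 y) +i*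
  rintegral (box a) (fun y => gi y * P1 y - gr' y * P2 y)).
rewrite !(poisson_convolution a0 wa)// uE vE complexM /G.
have cL z : `|csc alpha| ^+ n * ((2 * a) ^+ n * z) = z.
  by rewrite mulrA (csc_period n s0) mul1r.
by rewrite !cL !mul0r subr0 addr0.
Qed.
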